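(* Let $(M,g)$ be a compact, oriented smooth Riemannian manifold, let $\Phi:M\to M$ be an isometry, and let $v_1$ and $v_2$ be two smooth vector fields on $M$ such that $v_2=\Phi_*v_1$. Then the corresponding induced Hodge Laplacians satisfy $$\Phi^*\Delta_{v_2}\omega=\Delta_{v_1}\Phi^*\omega\qquad\text{for all }\omega\in\Omega^k(M).$$ Therefore $\Delta_{v_1}$ and $\Delta_{v_2}$ have exactly the same eigenvalues, and the corresponding eigenforms are identified by the pullback $\Phi^*$.
   Context: $\Omega^k(M)$ is the space of smooth differential $k$-forms, $d$ the exterior derivative, $\star$ the Hodge star of $g$, and $\delta=(-1)^k\star^{-1}d\star$ the codifferential on $k$-forms. For a smooth vector field $v$, let $v^\flat=g(v,\cdot)$, let $\iota_v$ be the interior product (zero on $0$-forms), and set $T_v=\mathrm{id}+v^\flat\wedge\iota_v$ on $k$-forms, which is a pointwise invertible bundle map. The $v$-induced codifferential is $\delta_v=T_v^{-1}\delta T_v$ (equivalently $(-1)^k\star_v^{-1}d\star_v$ on $k$-forms with $\star_v=\star T_v$), and the $v$-induced Hodge Laplacian is $\Delta_v=d\delta_v+\delta_v d$. *)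

(* Defs.v *)
From HB Require Import structures.
From mathcomp Require Import all_boot all_order all_algebra all_fingroup.
From mathcomp Require Import all_classical all_reals all_analysis.
Import Order.TTheory GRing.Theory Num.Theory.
Import numFieldNormedType.Exports.

Set Implicit Arguments.
Unset Strict Implicit.
Unset Printing Implicit Defensive.

Local Open Scope classical_set_scope.
Local Open Scope ring_scope.

(* A k-tuple of vectors of R^n is a matrix w : 'M_(k, n), one vector per row,
   and a k-covector is a function 'M[R]_(k, n) -> R satisfying [is_alt].
   A linear map with matrix J acts on vectors by u |-> u *m J, which is also
   the convention of [jacobian]. *)

Section LinearAlgebra.
Context {R : realType} {n : nat}.

Definition covector (k : nat) := 'M[R]_(k, n) -> R.

Definition is_alt k (a : covector k) : Prop :=
  (forall (A B C : 'M[R]_(k, n)) (i : 'I_k) (b c : R),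
     row i A = b *: row i B + c *: row i C ->
     row' i B = row' i A -> row' i C = row' i A ->
     a A = b * a B + c * a C) /\
  (forall (A : 'M[R]_(k, n)) (i j : 'I_k),
     i != j -> row i A = row j A -> a A = 0).

Definition ext_prod k l (a : covector k) (b : covector l) : covector (k + l) :=
  fun w => (k`! * l`!)%:R^-1 *
    \sum_(s : 'S_(k + l)) (-1) ^+ s *
      a (usubmx (row_perm s w)) * b (dsubmx (row_perm s w)).

Definition int_prod k (v : 'rV[R]_n) (a : covector k.+1) : covector k :=
  fun w => a (col_mx v w).

(* G is the Gram matrix of the scalar product. *)
Definition flat (G : 'M[R]_n) (v : 'rV[R]_n) : covector 1 :=
  fun u => (v *m G *m u^T) 0 0.

(* (1/k!) g^{i_1 j_1} ... g^{i_k j_k} a_{i_1 ... i_k} b_{j_1 ... j_k} *)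
Definition covector_inner k (G : 'M[R]_n) (a b : covector k) : R :=
  k`!%:R^-1 *
  \sum_(i : {ffun 'I_k -> 'I_n}) \sum_(j : {ffun 'I_k -> 'I_n})
    (\prod_(r < k) invmx G (i r) (j r)) *
    a (rowsub i 1%:M) * b (rowsub j 1%:M).

(* s = 1 or s = -1 is the sign of the standard basis of R^n. *)
Definition volume (G : 'M[R]_n) (s : R) (w : 'M[R]_n) : R :=
  s * Num.sqrt (\det G) * \det w.

(* b' = star b, through the defining property
   a /\ star b = <a, b> vol for all k-covectors a; false unless k + l = n. *)
Definition is_hodge k l (G : 'M[R]_n) (s : R)
    (b : covector k) (b' : covector l) : Prop :=
  exists e : (k + l)%N = n, forall a : covector k, is_alt a ->
    forall w : 'M[R]_(k + l, n),
      ext_prod a b' w = covector_inner G a b * volume G s (castmx (e, erefl n) w).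

(* The star and its inverse are only meaningful for k + l = n, and are 0
   otherwise. *)
Definition star k l (G : 'M[R]_n) (s : R) (b : covector k) : covector l :=
  xget (0 : _ -> R) [set b' | is_alt b' /\ is_hodge G s b b'].

Definition star_inv k l (G : 'M[R]_n) (s : R) (b' : covector l) : covector k :=
  xget (0 : _ -> R) [set b | is_alt b /\ is_hodge G s b b'].

(* id + v^flat /\ iota_v, where iota_v = 0 on 0-covectors. *)
Definition twist k (G : 'M[R]_n) (v : 'rV[R]_n) : covector k -> covector k :=
  match k with
  | 0%N => fun a => a
  | k'.+1 => fun a w => a w + ext_prod (flat G v) (int_prod v a) w
  end.

Definition twist_inv k (G : 'M[R]_n) (v : 'rV[R]_n) (b : covector k) :
    covector k :=
  xget (0 : _ -> R) [set a | is_alt a /\ twist G v a = b].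

End LinearAlgebra.

Section Smooth.
Context {R : realType} {E V : normedModType R}.

Fixpoint Cn_on (m : nat) (U : set E) (f : E -> V) : Prop :=
  match m with
  | 0%N => forall x, U x -> {for x, continuous f}
  | m'.+1 => (forall x, U x -> differentiable f x) /\
             (forall v : E, Cn_on m' U (fun x => 'D_v f x))
  end.

Definition smooth_on (U : set E) (f : E -> V) : Prop :=
  forall m, Cn_on m U f.

End Smooth.

Section Manifold.
Variables (R : realType) (n : nat) (M : topologicalType).

Record chart := Chart {
  cdom : set M;
  cmap : M -> 'rV[R]_n;
  cinv : 'rV[R]_n -> M }.

Definition is_chart (c : chart) : Prop :=
  [/\ open (cdom c) /\ open (cmap c @` cdom c),
      forall p, cdom c p -> {for p, continuous (cmap c)},
      forall y, (cmap c @` cdom c) y -> {for y, continuous (cinv c)} &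
      forall p, cdom c p -> cinv c (cmap c p) = p].

Record smooth_atlas := SmoothAtlas {
  charts : set chart;
  chart_at : M -> chart;
  chartsP : forall c, charts c -> is_chart c;
  chart_atP : forall p, charts (chart_at p) /\ cdom (chart_at p) p;
  transition_smooth : forall c c', charts c -> charts c' ->
    smooth_on (cmap c @` (cdom c `&` cdom c')) (cmap c' \o cinv c) }.

End Manifold.

(* The tangent space at p is 'rV_n: a tangent vector is given by its
   coordinates in the preferred chart [chart_at A p]. *)

Section Geometry.
Context {R : realType} {n : nat} {M : topologicalType}.
Variable A : smooth_atlas R n M.

Definition chart_change (c c' : chart R n M) (p : M) : 'M[R]_n :=
  jacobian (cmap c' \o cinv c) (cmap c p).

(* From coordinates in the chart c to the tangent space at p. *)
Definition from_chart (c : chart R n M) (p : M) : 'M[R]_n :=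
  chart_change c (chart_at A p) p.

Definition to_chart (c : chart R n M) (p : M) : 'M[R]_n :=
  chart_change (chart_at A p) c p.

Definition smooth_map (Phi : M -> M) : Prop :=
  continuous Phi /\
  forall c c', charts A c -> charts A c' ->
    smooth_on (cmap c @` (cdom c `&` Phi @^-1` cdom c'))
              (cmap c' \o Phi \o cinv c).

Definition tangent_map (Phi : M -> M) (p : M) : 'M[R]_n :=
  jacobian (cmap (chart_at A (Phi p)) \o Phi \o cinv (chart_at A p))
           (cmap (chart_at A p) p).

Definition smooth_field (v : M -> 'rV[R]_n) : Prop :=
  forall c, charts A c ->
    smooth_on (cmap c @` cdom c)
      (fun y => v (cinv c y) *m to_chart c (cinv c y)).

(* v2 = Phi_* v1, for Phi bijective. *)
Definition is_pushforward (Phi : M -> M) (v1 v2 : M -> 'rV[R]_n) : Prop :=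
  forall p, v2 (Phi p) = v1 p *m tangent_map Phi p.

Record riemannian_metric := RiemannianMetric {
  gram :> M -> 'M[R]_n;
  gram_sym : forall p, (gram p)^T = gram p;
  gram_pos : forall p (u : 'rV[R]_n), u != 0 -> 0 < (u *m gram p *m u^T) 0 0;
  gram_smooth : forall c, charts A c -> smooth_on (cmap c @` cdom c)
    (fun y => from_chart c (cinv c y) *m gram (cinv c y) *m
              (from_chart c (cinv c y))^T) }.

(* [orient p] is the sign of the standard basis of the tangent space at p; in
   each chart, the sign of the coordinate frame has to be locally constant. *)
Record orientation := Orientation {
  orient :> M -> R;
  orient_sign : forall p, orient p = 1 \/ orient p = -1;
  orient_locally_constant : forall c, charts A c -> forall p, cdom c p ->
    \forall q \near p, orient q * Num.sg (\det (from_chart c q)) =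
                       orient p * Num.sg (\det (from_chart c p)) }.

Definition is_isometry (g : riemannian_metric) (Phi : M -> M) : Prop :=
  (exists Psi : M -> M,
     [/\ cancel Phi Psi, cancel Psi Phi, smooth_map Phi & smooth_map Psi]) /\
  (forall p, tangent_map Phi p *m g (Phi p) *m (tangent_map Phi p)^T = g p).

(* Fields of arbitrary functions on k-tuples of tangent vectors; Omega^k(M) is
   the subset [smooth_form]. *)
Definition kform (k : nat) := M -> @covector R n k.

Definition form_in_chart k (c : chart R n M) (w : kform k) (y : 'rV[R]_n) :
    @covector R n k :=
  fun u => w (cinv c y) (u *m from_chart c (cinv c y)).

Definition smooth_form k (w : kform k) : Prop :=
  (forall p, is_alt (w p)) /\
  (forall c, charts A c -> forall u : 'M[R]_(k, n),
     smooth_on (cmap c @` cdom c) (fun y => form_in_chart c w y u : R^o)).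

Definition pullback k (Phi : M -> M) (w : kform k) : kform k :=
  fun p u => w (Phi p) (u *m tangent_map Phi p).

(* (dw)(u_0, ..., u_k) = \sum_i (-1)^i u_i (w (u_0, .., no u_i, .., u_k)) for
   vector fields u_i with constant coordinates in the preferred chart at p.
   Outside Omega^k(M), dw is 0 by convention. *)
Definition ext_deriv k (w : kform k) : kform k.+1 :=
  fun p u => if `[< smooth_form w >] then
    \sum_(i < k.+1) (-1) ^+ i *
      ('D_(row i u) (fun y => form_in_chart (chart_at A p) w y (row' i u) : R^o)
         (cmap (chart_at A p) p))
  else 0.

Variables (g : riemannian_metric) (o : orientation).

Definition star_form k l (w : kform k) : kform l :=
  fun p => star (g p) (o p) (w p).

Definition star_form_inv k l (w : kform l) : kform k :=
  fun p => star_inv (g p) (o p) (w p).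

Definition twist_form k (v : M -> 'rV[R]_n) (w : kform k) : kform k :=
  fun p => twist (g p) (v p) (w p).

Definition twist_form_inv k (v : M -> 'rV[R]_n) (w : kform k) : kform k :=
  fun p => twist_inv (g p) (v p) (w p).

(* On forms of degree k.+1 > n, which vanish, the truncated subtraction makes
   the degrees of the stars inconsistent and the result is 0. *)
Definition codiff k (w : kform k.+1) : kform k :=
  fun p u => (-1) ^+ k.+1 *
    star_form_inv (ext_deriv (star_form (l := (n - k.+1)%N) w)) p u.

Definition induced_codiff k (v : M -> 'rV[R]_n) (w : kform k.+1) : kform k :=
  twist_form_inv v (codiff (twist_form v w)).

Definition induced_laplacian k (v : M -> 'rV[R]_n) : kform k -> kform k :=
  match k with
  | 0%N => fun w => induced_codiff v (ext_deriv w)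
  | k'.+1 => fun w p u =>
      ext_deriv (induced_codiff v w) p u + induced_codiff v (ext_deriv w) p u
  end.

Definition eigenforms k (v : M -> 'rV[R]_n) (lam : R) : set (kform k) :=
  [set w | [/\ smooth_form w, exists p u, w p u != 0 &
               forall p u, induced_laplacian v w p u = lam * w p u]].

Definition is_eigenvalue k (v : M -> 'rV[R]_n) (lam : R) : Prop :=
  exists w : kform k, eigenforms v lam w.

End Geometry.

Arguments is_eigenvalue {R n M A} g o k v lam.
Arguments eigenforms {R n M A} g o k v lam.

(* Main.v *)
Require Import Defs.
From HB Require Import structures.
From mathcomp Require Import all_boot all_order all_algebra all_fingroup.
From mathcomp Require Import all_classical all_reals all_analysis.
From mathcomp Require Import ring lra.
Import Order.TTheory GRing.Theory Num.Theory.
Import numFieldNormedType.Exports.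

Set Implicit Arguments.
Unset Strict Implicit.
Unset Printing Implicit Defensive.

Local Open Scope classical_set_scope.
Local Open Scope ring_scope.

(** The Laplacian of v is assembled from the metric, the orientation, the field
    v and the exterior derivative, so it is carried along by a diffeomorphism
    that preserves the metric and sends v1 to v2.  An isometry may reverse the
    orientation, and may do so on some components of M only; but the
    codifferential contains one star and one inverse star, and d commutes with
    multiplication by a locally constant function, so the two signs cancel.

    Pointwise, the tangent map of Phi at p is an invertible matrix J with
    J G' J^T = G, where G and G' are the Gram matrices at p and Phi p.  The
    scalar product of covectors, the volume form, the wedge product and the
    twist by a vector are natural under such a J, the volume only up to the sign
    of [det J].  The star, its inverse and the inverse of the twist are defined
    by a choice among the solutions of an equation.  Naturality of the equation
    passes to the chosen solution because the solution is unique
    ([star_unique], [star_inv_unique], [twist_inj]) and because equations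
    correspond in both directions, so that both have a solution or neither has
    ([xget_image]).  This gives [star_comp], [star_inv_comp] and
    [twist_inv_comp].

    For the exterior derivative, write Phi in charts as a smooth map F of R^n
    with Jacobian J.  Differentiating W (F z) (u J(z)) gives the derivative of
    W along J, which is the pullback of dW, together with terms containing the
    second derivatives of F; these cancel in the alternating sum since second
    derivatives are symmetric ([derive_symmetric], [alt_symmetric_cancel],
    [ext_d_comp]).  The chain rule ([local_jac_comp]) transports this to M.

    Whether a form is smooth is compared on the two sides rather than decided:
    the derivative of a form which is not smooth is 0 by convention, and pulling
    back along Phi and along its inverse shows that a form is smooth exactly when
    its pullback is; so d commutes with the pullback on arbitrary fields of
    covectors ([ext_deriv_scaled_pullback]).  Similarly the star is shown to be
    natural on fields of multilinear maps, which covers dw and the twist of w.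

    The eigenforms correspond because the pullbacks along Phi and along its
    inverse are inverse to each other. *)

(** * Multilinear covectors *)

Section Multilinear.
Context {R : realType} {n : nat}.

(** The first clause of [is_alt], with the rows other than i compared one by one
    instead of through [row'], a form that is stable under reindexing of rows. *)
Definition multilinear k (a : @covector R n k) : Prop :=
  forall (A B C : 'M[R]_(k, n)) (i : 'I_k) (b c : R),
    row i A = b *: row i B + c *: row i C ->
    (forall r, r != i -> row r B = row r A) ->
    (forall r, r != i -> row r C = row r A) ->
    a A = b * a B + c * a C.

Lemma row'_eqP k (A B : 'M[R]_(k, n)) i :
  (forall r, r != i -> row r B = row r A) <-> row' i B = row' i A.
Proof.
split=> [h|h r ri].
  apply/row_matrixP => r; rewrite !rowEsub !row'Esub -!rowsub_comp.
  by have := h (lift i r); rewrite !rowEsub; apply; rewrite eq_sym neq_lift.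
have [r' ->|] := unliftP i r; last by move=> e; rewrite e eqxx in ri.
apply/rowP => c; have /matrixP/(_ r' c) := h.
by rewrite !mxE.
Qed.

Lemma is_alt_multilinear k (a : @covector R n k) : is_alt a -> multilinear a.
Proof.
by move=> [h _] A B C i b c e /row'_eqP hB /row'_eqP hC; apply: h e _ _.
Qed.

Lemma linear_comb (f : 'rV[R]_n -> R) m (q : 'I_m -> R) (x : 'I_m -> 'rV[R]_n) :
  (forall b c u v, f (b *: u + c *: v) = b * f u + c * f v) ->
  f (\sum_j q j *: x j) = \sum_j q j * f (x j).
Proof.
move=> fl.
have f0 : f 0 = 0 by have := fl 0 0 0 0; rewrite !scale0r !mul0r !addr0.
apply: (big_rec2 (fun u s => f u = s)) => // j u s _ <-.
by rewrite -[X in f (_ + X)]scale1r fl mul1r.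
Qed.

Lemma row_cons0 k (u : 'rV[R]_n) (W : 'M[R]_(k, n)) :
  row (ord0 : 'I_k.+1) (col_mx u W) = u.
Proof.
by apply/rowP => j; rewrite !mxE; case: splitP => // i _; rewrite ord1.
Qed.

Lemma row_consS k (u : 'rV[R]_n) (W : 'M[R]_(k, n)) i :
  row (lift ord0 i : 'I_k.+1) (col_mx u W) = row i W.
Proof.
apply/rowP => j; rewrite !mxE; case: splitP => [r|r /= e]; first by rewrite ord1.
by congr (W _ _); apply: val_inj; move: e; rewrite /= => -[].
Qed.

(** Restores the block form of a matrix with [k.+1] rows, which the block lemmas
    do not recognise as having 1 + k rows. *)
Lemma cons_rowE k (A : 'M[R]_(k.+1, n)) :
  A = col_mx (row ord0 A) (row' ord0 A) :> 'M[R]_(k.+1, n).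
Proof.
apply/row_matrixP => r; case: (unliftP ord0 r) => [r'|] ->.
  by rewrite row_consS; apply/rowP => c; rewrite !mxE.
by rewrite row_cons0.
Qed.

Lemma multilinear_col_mx k (a : @covector R n k.+1) (W : 'M[R]_(k, n)) b c u v :
  multilinear a ->
  a (col_mx (b *: u + c *: v) W : 'M[R]_(1 + k, n)) =
  b * a (col_mx u W : 'M[R]_(1 + k, n)) + c * a (col_mx v W : 'M[R]_(1 + k, n)).
Proof.
move=> h; apply: (h _ _ _ ord0); first by rewrite !row_cons0.
- by move=> r; case: (unliftP ord0 r) => [r'|] -> // _; rewrite !row_consS.
- by move=> r; case: (unliftP ord0 r) => [r'|] -> // _; rewrite !row_consS.
Qed.

Lemma int_prod_multilinear k (a : @covector R n k.+1) v :
  multilinear a -> multilinear (int_prod v a).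
Proof.
move=> h A B C i b c e hB hC; rewrite /int_prod.
apply: (h _ _ _ (lift ord0 i)); first by rewrite !row_consS.
- move=> r; case: (unliftP ord0 r) => [r'|] -> ri; last by rewrite !row_cons0.
  by rewrite !row_consS hB //; apply: contraNneq ri => ->.
- move=> r; case: (unliftP ord0 r) => [r'|] -> ri; last by rewrite !row_cons0.
  by rewrite !row_consS hC //; apply: contraNneq ri => ->.
Qed.

(** Expansion along the rows of w: by induction on k, splitting off the first row
    of Q and applying the induction hypothesis to the contraction of a by each
    row of w. *)
Lemma multilinear_mul k m (a : @covector R n k) (Q : 'M[R]_(k, m))
    (w : 'M[R]_(m, n)) : multilinear a ->
  a (Q *m w) =
  \sum_(f : {ffun 'I_k -> 'I_m}) (\prod_r Q r (f r)) * a (rowsub f w).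
Proof.
elim: k a Q => [|k IHk] a Q ha.
  rewrite (big_pred1 [ffun i : 'I_0 => False_rect _ (notF (ltn_ord i))]) => [|f].
    by rewrite big_ord0 mul1r; congr a; apply/matrixP => -[].
  by apply/esym/eqP/ffunP => -[].
rewrite [Q *m w]cons_rowE row_mul mulmx_sum_row row'Esub -mul_rowsub_mx -row'Esub.
under eq_bigr do rewrite mxE.
pose F (u : 'rV[R]_n) := a (col_mx u (row' ord0 Q *m w) : 'M[R]_(k.+1, n)).
rewrite -/(F _) linear_comb; last by move=> *; exact: multilinear_col_mx.
(* The pair (j, f) stands for the function with value j at 0 followed by f. *)
pose h (p : 'I_m * {ffun 'I_k -> 'I_m}) : {ffun 'I_k.+1 -> 'I_m} :=
  [ffun i => oapp p.2 p.1 (unlift ord0 i)].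
have hh : bijective h.
  exists (fun f : {ffun 'I_k.+1 -> 'I_m} => (f ord0, [ffun i => f (lift ord0 i)])) => [[j f]|f].
    rewrite /h /= ffunE unlift_none /=; congr pair.
    by apply/ffunP => i; rewrite !ffunE liftK.
  by apply/ffunP => i; rewrite !ffunE; case: unliftP => [?|] -> //=; rewrite ffunE.
rewrite [RHS](reindex h) /=; last exact: onW_bij.
rewrite -(pair_bigA _ (fun j f =>
  (\prod_r Q r (h (j, f) r)) * a (rowsub (h (j, f)) w))) /=.
apply: eq_bigr => j _.
rewrite /F -[a _]/(int_prod (row j w) a _) IHk; last exact: int_prod_multilinear.
rewrite big_distrr /=; apply: eq_bigr => f _.
rewrite big_ord_recl mulrA; congr (_ * _ * _).
- by rewrite ffunE unlift_none.
- by apply: eq_bigr => r _; rewrite ffunE liftK /= mxE.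
- rewrite /int_prod; congr a; apply/row_matrixP => r.
  case: (unliftP ord0 r) => [r'|] ->.
    by rewrite row_consS !row_rowsub ffunE liftK.
  by rewrite row_cons0 row_rowsub ffunE unlift_none.
Qed.

End Multilinear.

(** * Alternating covectors and determinants *)

Section Alternating.
Context {R : realType} {n : nat}.

(** Polarization: a vanishes when rows i and j are both equal to x + y. *)
Lemma alt_swap k (a : @covector R n k) (w : 'M[R]_(k, n)) i j :
  is_alt a -> i != j -> a (row_perm (tperm i j) w) = - a w.
Proof.
move=> ha ij; have hm := is_alt_multilinear ha; case: ha => _ h0.
pose W x y : 'M[R]_(k, n) :=
  \matrix_r (if r == i then x else if r == j then y else row r w).
have Wi x y : row i (W x y) = x by rewrite rowK eqxx.
have Wj x y : row j (W x y) = y by rewrite rowK eq_sym (negPf ij) eqxx.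
have Dl x1 x2 y : a (W (x1 + x2) y) = a (W x1 y) + a (W x2 y).
  rewrite (hm _ (W x1 y) (W x2 y) i 1 1) ?mul1r ?Wi ?scale1r // => r ri;
    by rewrite !rowK (negPf ri).
have Dr x y1 y2 : a (W x (y1 + y2)) = a (W x y1) + a (W x y2).
  rewrite (hm _ (W x y1) (W x y2) j 1 1) ?mul1r ?Wj ?scale1r // => r rj;
    by rewrite !rowK (negPf rj).
have D0 x : a (W x x) = 0 by apply: (h0 _ i j ij); rewrite Wi Wj.
have -> : row_perm (tperm i j) w = W (row j w) (row i w).
  apply/row_matrixP => r; rewrite rowK row_permEsub row_rowsub.
  by case: tpermP => [->|->|/eqP/negPf -> /eqP/negPf -> //];
     rewrite ?eqxx // eq_sym (negPf ij).
have wE : w = W (row i w) (row j w).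
  apply/row_matrixP => r; rewrite rowK.
  by case: eqP => [->|_] //; case: eqP => [->|].
rewrite [X in - a X]wE.
apply/eqP; rewrite -addr_eq0 addrC; apply/eqP.
by have := D0 (row i w + row j w); rewrite Dl !Dr !D0 add0r addr0.
Qed.

Lemma alt_row_perm k (a : @covector R n k) (w : 'M[R]_(k, n)) (s : 'S_k) :
  is_alt a -> a (row_perm s w) = (-1) ^+ s * a w.
Proof.
move=> ha; have [ts -> dts] := prod_tpermP s.
elim: ts w dts => [|[i j] ts IH] w /=.
  by rewrite big_nil odd_perm1 row_perm1 mul1r.
case/andP => ij dts; rewrite big_cons /= row_permM (alt_swap _ ha ij) IH //.
by rewrite odd_permM odd_tperm ij signr_addb mulN1r mulNr.
Qed.

(** The universal property of the determinant; it handles all the signs that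
    occur below, in particular those of permutations of arguments. *)
Lemma alt_mul_det k (a : @covector R n k) (Q : 'M[R]_k) (w : 'M[R]_(k, n)) :
  is_alt a -> a (Q *m w) = \det Q * a w.
Proof.
move=> ha; rewrite (multilinear_mul _ _ (is_alt_multilinear ha)).
rewrite (bigID (fun f : {ffun _} => injectiveb f)) /= [X in _ + X]big1 => [|f]; last first.
  move=> /injectivePn[i [j ij fij]].
  by rewrite (proj2 ha _ i j ij) ?mulr0 // !row_rowsub fij.
rewrite addr0 (reindex_onto (@pval _) (fun f => insubd (1%g : 'S_k) f)) /=; last first.
  by move=> f fi; rewrite insubdK.
rewrite big_distrl /=; apply: eq_big => [s|s _].
  by rewrite valKd eqxx (valP s).
have -> : rowsub (\val s) w = row_perm s w by apply/matrixP => r c; rewrite !mxE pvalE.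
rewrite alt_row_perm // mulrA; congr (_ * _); rewrite mulrC; congr (_ * _).
by apply: eq_bigr => r _; rewrite pvalE.
Qed.

Lemma det_alt k (P : 'M[R]_(n, k)) : is_alt (fun u : 'M[R]_(k, n) => \det (u *m P)).
Proof.
split=> [A B C i b c e hB hC|A i j ij e].
  apply: (@determinant_multilinear _ _ _ _ _ i); rewrite ?row_mul ?e.
  - by rewrite mulmxDl !scalemxAl.
  - by rewrite !row'Esub -!mul_rowsub_mx -!row'Esub hB.
  - by rewrite !row'Esub -!mul_rowsub_mx -!row'Esub hC.
apply: (determinant_alternate ij) => r.
have /rowP/(_ r) : row i (A *m P) = row j (A *m P) by rewrite !row_mul e.
by rewrite ![row _ _ _ _]mxE.
Qed.

Lemma alt_comp k (J : 'M[R]_n) (a : @covector R n k) :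
  is_alt a -> is_alt (fun u => a (u *m J)).
Proof.
move=> [h1 h2]; split=> [A B C i b c e hB hC|A i j ij e].
  apply: (h1 _ _ _ i); rewrite ?row_mul ?e ?mulmxDl -?scalemxAl //.
  - by rewrite !row'Esub -!mul_rowsub_mx -!row'Esub hB.
  - by rewrite !row'Esub -!mul_rowsub_mx -!row'Esub hC.
by apply: (h2 _ i j ij); rewrite !row_mul e.
Qed.

Lemma multilinear_comp k (J : 'M[R]_n) (a : @covector R n k) :
  multilinear a -> multilinear (fun u => a (u *m J)).
Proof.
move=> h A B C i b c e hB hC.
apply: (h _ _ _ i); rewrite ?row_mul ?e ?mulmxDl -?scalemxAl // => r ri.
- by rewrite !row_mul hB.
- by rewrite !row_mul hC.
Qed.

Lemma alt_scale k e (a : @covector R n k) : is_alt a -> is_alt (fun u => e * a u).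
Proof.
move=> [h1 h2]; split=> [A B C i b c ? hB hC|A i j ij ?].
  by rewrite (h1 A B C i b c) //; ring.
by rewrite (h2 A i j) ?mulr0.
Qed.

(** Laplace expansion of a determinant with two equal rows, along an added first
    column that is 1 in these two rows and 0 elsewhere. *)
Lemma det_row'_eq k (x : 'M[R]_(k.+1, k)) i j : i != j -> row i x = row j x ->
  (-1) ^+ i * \det (row' i x) + (-1) ^+ j * \det (row' j x) = 0.
Proof.
move=> ij e.
pose y : 'M[R]_(k.+1) := row_mx (\col_r ((r == i) || (r == j))%:R : 'cV_(k.+1)) x.
have yx r (c : 'I_k) : y r (lift ord0 c) = x r c.
  rewrite mxE; case: splitP => [s|s /= es]; first by rewrite ord1.
  by congr (x _ _); apply: val_inj; apply: (@addnI 1); rewrite -es.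
have y0 r : y r ord0 = ((r == i) || (r == j))%:R.
  by rewrite mxE; case: splitP => [s _|s //]; rewrite mxE.
have : \det y = 0.
  apply: (determinant_alternate ij) => c; case: (unliftP ord0 c) => [c'|] ->.
    by rewrite !yx; have /rowP/(_ c') := e; rewrite !mxE.
  by rewrite !y0 !eqxx orbT.
rewrite (expand_det_col _ ord0) (bigD1 i) //= (bigD1 j) 1?eq_sym //= big1 /cofactor => [|r].
  have -> : col' ord0 y = x by apply/matrixP => r c; rewrite [LHS]mxE yx.
  by rewrite addr0 !y0 !eqxx orbT !mul1r !addn0.
by case/andP => /negPf ri /negPf rj; rewrite y0 ri rj mul0r.
Qed.

(** The two matrices [row' i x] and [row' j x] have the same rows in a different
    order.  Writing x = T * [row' i x] for a 0-1 matrix T reduces the sign of the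
    reordering to the case of determinants. *)
Lemma alt_row'_eq k (a : @covector R n k) (x : 'M[R]_(k.+1, n)) i j :
  is_alt a -> i != j -> row i x = row j x ->
  (-1) ^+ i * a (row' i x) + (-1) ^+ j * a (row' j x) = 0.
Proof.
move=> ha ij e.
(* Row i, missing from [row' i x], is read off row j. *)
pose h r := if r == i then j else r.
pose T : 'M[R]_(k.+1, k) := \matrix_(r, c) (lift i c == h r)%:R.
have hx r : row r x = row (h r) x by rewrite /h; case: eqP => [->|].
have Tx : T *m row' i x = x.
  apply/row_matrixP => r; rewrite row_mul mulmx_sum_row [in RHS]hx.
  have [c hc|hi] := unliftP i (h r); last first.
    by exfalso; move: hi; rewrite /h; case: (eqVneq r i) => [_ /eqP|/eqP//];
       rewrite eq_sym (negPf ij).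
  rewrite (bigD1 c) //= big1 => [|c' cc']; rewrite !mxE ?hc ?eqxx.
    by rewrite scale1r addr0; apply/rowP => ?; rewrite !mxE.
  by case: eqP => [/lift_inj ecc|_]; [rewrite ecc eqxx in cc' | rewrite scale0r].
have R' r : row' r x = row' r T *m row' i x.
  by rewrite !row'Esub mul_rowsub_mx -row'Esub Tx.
have Tij : row i T = row j T.
  by apply/rowP => c; rewrite !mxE /h eqxx if_same.
rewrite [in X in X + _]R' [in X in _ + X]R' !(alt_mul_det _ _ ha).
by rewrite !mulrA -mulrDl det_row'_eq // mul0r.
Qed.

End Alternating.

(** * Scalar product, volume and uniqueness of the Hodge star *)

Section Hodge.
Context {R : realType} {n : nat}.
Implicit Types (G J : 'M[R]_n).

(** The sum depends on X and Y through X^T Y only.  This expresses the scalar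
    product of covectors in any pair of frames instead of the standard one. *)
Lemma sum_rowsub_mul k p (a b : @covector R n k) (X Y : 'M[R]_(p, n)) :
  multilinear a -> multilinear b ->
  \sum_(j : {ffun 'I_k -> 'I_p}) a (rowsub j X) * b (rowsub j Y) =
  \sum_(i : {ffun 'I_k -> 'I_n}) \sum_(j : {ffun 'I_k -> 'I_n})
    (\prod_r (X^T *m Y) (i r) (j r)) * a (rowsub i 1%:M) * b (rowsub j 1%:M).
Proof.
move=> ha hb.
under eq_bigr => j _.
  rewrite -[rowsub j X]mulmx1 -[rowsub j Y]mulmx1 !multilinear_mul //.
  rewrite big_distrlr /=; over.
rewrite exchange_big; apply: eq_bigr => i _ /=.
rewrite exchange_big; apply: eq_bigr => l _ /=.
transitivity (\sum_(j : {ffun 'I_k -> 'I_p}) (\prod_r (X (j r) (i r) * Y (j r) (l r))) *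
   (a (rowsub i 1%:M) * b (rowsub l 1%:M))).
  apply: eq_bigr => j _; rewrite big_split /= mulrACA.
  by congr (_ * _ * _); apply: eq_bigr => r _; rewrite !mxE.
rewrite -big_distrl /= mulrA; congr (_ * _ * _).
rewrite -(bigA_distr_bigA (fun r q => X q (i r) * Y q (l r))) /=.
by apply: eq_bigr => r _; rewrite mxE; apply: eq_bigr => q _; rewrite mxE.
Qed.

Lemma covector_innerE k p G (a b : @covector R n k) (X Y : 'M[R]_(p, n)) :
  multilinear a -> multilinear b -> X^T *m Y = invmx G ->
  covector_inner G a b =
  k`!%:R^-1 * \sum_(j : {ffun 'I_k -> 'I_p}) a (rowsub j X) * b (rowsub j Y).
Proof. by move=> ha hb e; rewrite sum_rowsub_mul // e. Qed.

(** The inverse Gram matrix of G' is J^T G^-1 J, so two frames X and Y with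
    X^T Y = G^-1, both multiplied by J, compute the scalar product of G'. *)
Lemma covector_inner_comp k G G' J (a b : @covector R n k) :
  multilinear a -> multilinear b -> G' \in unitmx -> J \in unitmx ->
  J *m G' *m J^T = G ->
  covector_inner G (fun u => a (u *m J)) (fun u => b (u *m J)) =
  covector_inner G' a b.
Proof.
move=> ha hb uG' uJ e.
have uG : G \in unitmx by rewrite -e !unitmx_mul uJ uG' unitmx_tr uJ.
rewrite (@covector_innerE _ _ G _ _ (invmx G)^T 1%:M);
  [|exact: multilinear_comp|exact: multilinear_comp|by rewrite trmxK mulmx1].
rewrite (@covector_innerE _ _ G' _ _ ((invmx G)^T *m J) (1%:M *m J)) //.
  by congr (_ * _); apply: eq_bigr => j _; rewrite !mul_rowsub_mx.
rewrite trmx_mul trmxK mul1mx.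
apply: (can_inj (mulKmx uG')); rewrite mulmxV //.
apply: (can_inj (mulKmx uJ)); rewrite mulmx1 !mulmxA e mulmxV //.
by rewrite mul1mx.
Qed.

(** Pairing with the decomposable covector [det (u P)] evaluates b.  This is the
    nondegeneracy of the scalar product in explicit form.  The proof expands the
    determinant by the Leibniz formula; each of the k! permutations contributes
    the same value. *)
Lemma covector_inner_det k G (b : @covector R n k) (P : 'M[R]_(n, k)) :
  is_alt b -> covector_inner G (fun u => \det (u *m P)) b = b (P^T *m invmx G).
Proof.
move=> hb; have hm := is_alt_multilinear hb.
rewrite (@covector_innerE _ _ _ _ _ (invmx G)^T 1%:M) ?trmxK ?mulmx1 //; last first.
  exact/is_alt_multilinear/det_alt.
set Z := (invmx G)^T *m P.
transitivity (k`!%:R^-1 * \sum_(s : 'S_k) (-1) ^+ s * b (row_perm s Z^T)).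
  congr (_ * _); under eq_bigr do rewrite mul_rowsub_mx -/Z big_distrl /=.
  rewrite exchange_big; apply: eq_bigr => s _ /=.
  rewrite -[row_perm s _]mulmx1 multilinear_mul // big_distrr /=.
  apply: eq_bigr => j _; rewrite mulrA; congr (_ * _ * _).
  rewrite [RHS](reindex_inj (@perm_inj _ s^-1%g)) /=.
  rewrite [LHS](reindex_inj (@perm_inj _ s^-1%g)) /=.
  by apply: eq_bigr => r _; rewrite !mxE.
under eq_bigr do rewrite alt_row_perm // mulrA -signr_addb addbb mul1r.
rewrite sumr_const card_Sn -[b _ *+ _]mulr_natl mulKf //.
by rewrite /Z trmx_mul trmxK.
Qed.

Lemma ext_prod_comp k l (a : @covector R n k) (b : @covector R n l) J w :
  ext_prod (fun u => a (u *m J)) (fun u => b (u *m J)) w = ext_prod a b (w *m J).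
Proof.
rewrite /ext_prod; congr (_ * _); apply: eq_bigr => s _.
by rewrite usubmxEsub dsubmxEsub !row_permEsub !mul_rowsub_mx.
Qed.

Lemma ext_prodZr k l (a : @covector R n k) (b : @covector R n l) e w :
  ext_prod a (fun u => e * b u) w = e * ext_prod a b w.
Proof.
rewrite /ext_prod mulrCA; congr (_ * _); rewrite big_distrr /=.
by apply: eq_bigr => s _; rewrite mulrCA.
Qed.

(** sqrt (det G) = |det J| sqrt (det G'), and |det J| = sg (det J) det J. *)
Lemma volume_comp G G' J s s' w : s' * s' = 1 -> J *m G' *m J^T = G ->
  s * s' * Num.sg (\det J) * volume G' s' (w *m J) = volume G s w.
Proof.
move=> ss <-; rewrite /volume !det_mulmx det_tr.
have -> : \det J * \det G' * \det J = \det J ^+ 2 * \det G' by ring.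
rewrite sqrtrM ?sqr_ge0 // sqrtr_sqr normrEsg.
by rewrite -[RHS]mul1r -ss; ring.
Qed.

(** The defining equation of the star is tested on all alternating a; a general
    a is the pullback under J of its pullback under J^-1. *)
Lemma is_hodge_comp k l G G' J s s' (b : @covector R n k) (b' : @covector R n l) :
  s' * s' = 1 -> multilinear b -> J \in unitmx -> J *m G' *m J^T = G ->
  0 < \det G' -> is_hodge G' s' b b' ->
  is_hodge G s (fun u => b (u *m J))
    (fun u => s * s' * Num.sg (\det J) * b' (u *m J)).
Proof.
move=> ss hb uJ eG dG' [e he]; exists e => a ha w.
have uG' : G' \in unitmx by rewrite unitmxE unitfE gt_eqF.
rewrite (ext_prodZr _ (fun u => b' (u *m J))).
have aE : a = (fun u => a (u *m J *m invmx J)).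
  by apply: funext => u; rewrite mulmxK.
have -> : ext_prod a (fun u => b' (u *m J)) w =
    ext_prod (fun u => a (u *m invmx J)) b' (w *m J).
  by rewrite -[RHS]ext_prod_comp /= {1}aE.
rewrite he; last exact: alt_comp.
have -> : covector_inner G' (fun u => a (u *m invmx J)) b =
          covector_inner G a (fun u => b (u *m J)).
  rewrite [in RHS]aE (covector_inner_comp (a := fun u => a (u *m invmx J)) _ _ uG' uJ eG) //.
  exact/is_alt_multilinear/alt_comp.
have -> : castmx (e, erefl n) (w *m J) = castmx (e, erefl n) w *m J.
  by case: n / e J w {eG uJ aE he dG' uG' ha hb a G G' b b'}.
by rewrite -(volume_comp _ _ ss eG); ring.
Qed.

(** A choice commutes with f as soon as the chosen element is unique on the target
    side; the premise on nonemptiness matches the default values. *)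
Lemma xget_image (X Y : choiceType) (P : set X) (Q : set Y) (f : X -> Y) x0 y0 :
  f x0 = y0 -> (forall x : X, P x -> Q (f x)) -> (Q !=set0 -> P !=set0) ->
  (forall y z : Y, Q y -> Q z -> y = z) ->
  xget y0 Q = f (xget x0 P).
Proof.
move=> f0 PQ QP Q1.
have [Pe|Pe] := pselect (exists x, P x).
  have Px : P (xget x0 P) := xgetPex x0 Pe.
  by apply: xget_unique => [|y Qy]; [exact: PQ|apply: Q1 => //; exact: PQ].
rewrite !xgetPN // => z; first by move=> Pz; apply: Pe; exists z.
by move=> Qz; apply: Pe; apply: QP; exists z.
Qed.

(** A permutation matrix whose upper left (or lower right) block has a nonzero
    determinant maps each of the two index blocks to itself: otherwise that block
    would have a zero row or a zero column. *)
Lemma perm_mx_block k l (s : 'S_(k + l)) (Q := perm_mx s : 'M[R]_(k + l)) :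
  (\det (ulsubmx Q) != 0) || (\det (drsubmx Q) != 0) ->
  ursubmx Q = 0 /\ dlsubmx Q = 0.
Proof.
have QE i j : Q i j = (s i == j)%:R by rewrite !mxE.
clearbody Q.
have det0 m (T : 'M[R]_m) i : (forall j, T i j = 0) -> \det T = 0.
  by move=> Ti; rewrite (expand_det_row _ i) big1 // => j _; rewrite Ti mul0r.
have det0' m (T : 'M[R]_m) j : (forall i, T i j = 0) -> \det T = 0.
  by move=> Ti; rewrite (expand_det_col _ j) big1 // => i _; rewrite Ti mul0r.
move=> h; split; apply/matrixP => i j.
- rewrite !mxE QE; case: eqP => // e; exfalso; case/orP: h => /eqP; apply.
    by apply: (det0 _ _ i) => c; rewrite !mxE QE e eq_sym eq_lrshift.
  apply: (det0' _ _ j) => r; rewrite !mxE QE -e (inj_eq perm_inj).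
  by rewrite eq_sym eq_lrshift.
- rewrite !mxE QE; case: eqP => // e; exfalso; case/orP: h => /eqP; apply.
    by apply: (det0' _ _ j) => r; rewrite !mxE QE -e (inj_eq perm_inj) eq_lrshift.
  by apply: (det0 _ _ i) => c; rewrite !mxE QE e eq_lrshift.
Qed.

Lemma sign_perm_mx_block k l (s : 'S_(k + l)) (Q := perm_mx s : 'M[R]_(k + l)) :
  ursubmx Q = 0 -> (-1) ^+ s * \det (ulsubmx Q) * \det (drsubmx Q) = 1.
Proof.
move=> ur; rewrite -mulrA -(det_lblock _ (dlsubmx Q)) -[X in block_mx _ X]ur submxK.
by rewrite det_perm -signr_addb addbb.
Qed.

(** A term is 1 if s preserves the two blocks of indices and 0 otherwise, so this
    is the number k! l! of such permutations. *)
Definition shuffle_count k l : R :=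
  \sum_(s : 'S_(k + l)) (-1) ^+ s * \det (ulsubmx (perm_mx s)) * \det (drsubmx (perm_mx s)).

Lemma shuffle_count_gt0 k l : 0 < shuffle_count k l.
Proof.
have h0 (s : 'S_(k + l)) : 0 <= (-1) ^+ s * \det (ulsubmx (perm_mx s : 'M[R]_(k + l)))
     * \det (drsubmx (perm_mx s)).
  case: (eqVneq (\det (ulsubmx (perm_mx s : 'M[R]_(k + l)))) 0) => [->|ul].
    by rewrite mulr0 mul0r.
  by rewrite sign_perm_mx_block //; case: (@perm_mx_block k l s) => //; rewrite ul.
rewrite /shuffle_count (bigD1 1%g) //= ltr_wpDr ?sumr_ge0 //.
rewrite sign_perm_mx_block // perm_mx1; apply/matrixP => i j.
by rewrite !mxE eq_lrshift.
Qed.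

(** On the rows of Q and w the covector [det (u P)] only sees the part of the
    permutation inside the first block, so only block permutations contribute,
    each with the same value b w. *)
Lemma ext_prod_det k l (b : @covector R n l) (P : 'M[R]_(n, k)) (Q : 'M[R]_(k, n))
    (w : 'M[R]_(l, n)) :
  is_alt b -> Q *m P = 1%:M -> w *m P = 0 ->
  ext_prod (fun u => \det (u *m P)) b (col_mx Q w) =
  (k`! * l`!)%:R^-1 * shuffle_count k l * b w.
Proof.
move=> hb QP wP; rewrite /ext_prod -mulrA; congr (_ * _).
rewrite big_distrl /=; apply: eq_bigr => s _.
rewrite -!mulrA; congr (_ * _).
have -> : usubmx (row_perm s (col_mx Q w)) *m P = ulsubmx (perm_mx s).
  rewrite row_permE -mul_usub_mx -mulmxA mul_col_mx QP wP.
  by rewrite -[usubmx _]hsubmxK mul_row_col mulmx1 mulmx0 addr0.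
case: (eqVneq (\det (ulsubmx (perm_mx s : 'M[R]_(k + l)))) 0) => [->|ul].
  by rewrite !mul0r.
case: (@perm_mx_block k l s); first by rewrite ul.
move=> ur dl; rewrite row_permE -mul_dsub_mx.
rewrite -[dsubmx _]hsubmxK -/(dlsubmx _) -/(drsubmx _) dl mul_row_col mul0mx add0r.
by rewrite alt_mul_det.
Qed.

(** Nondegeneracy of the wedge pairing.  To recover b w, take for the columns of P
    k independent vectors orthogonal to the rows of w (there are at least
    n - l = k of them), and for Q a left inverse of P. *)
Lemma star_unique k l (b1 b2 : @covector R n l) : (k + l)%N = n ->
  is_alt b1 -> is_alt b2 ->
  (forall a : @covector R n k, is_alt a -> ext_prod a b1 =1 ext_prod a b2) ->
  b1 = b2.
Proof.
move=> e h1 h2 h; apply: funext => w.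
have rk : (k <= \rank (kermx w^T))%N.
  rewrite mxrank_ker leq_subRL ?rank_leq_row // addnC -[X in (_ <= X)%N]e.
  by rewrite leq_add2l mxrank_tr rank_leq_row.
pose Q0 : 'M[R]_(k, n) := pid_mx k *m row_base (kermx w^T).
have fQ0 : row_free Q0.
  by rewrite /row_free mxrankMfree ?row_base_free // rank_pid_mx.
have Q0w : w *m Q0^T = 0.
  apply: trmx_inj; rewrite trmx_mul trmxK trmx0 /Q0 -mulmxA.
  have -> : row_base (kermx w^T) *m w^T = 0.
    by apply/eqP; rewrite -sub_kermx eq_row_base.
  by rewrite mulmx0.
have [B Q0B] := row_freeP fQ0.
have QP : B^T *m Q0^T = 1%:M by rewrite -trmx_mul Q0B trmx1.
have := h _ (det_alt Q0^T) (col_mx B^T w).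
rewrite !ext_prod_det //; apply: mulfI.
by rewrite mulf_neq0 ?gt_eqF ?shuffle_count_gt0.
Qed.

End Hodge.

(** * Pointwise naturality of the star and of the twist *)

Section Natural.
Context {R : realType} {n : nat}.
Implicit Types (G J : 'M[R]_n).

(** The equation determines the scalar products with the covectors [det (u P)],
    because the volume does not vanish on the standard basis. *)
Lemma star_inv_unique k l G s (b1 b2 : @covector R n k) (b' : @covector R n l) :
  s * s = 1 -> 0 < \det G -> is_alt b1 -> is_alt b2 ->
  is_hodge G s b1 b' -> is_hodge G s b2 b' -> b1 = b2.
Proof.
move=> ss dG h1 h2 [e H1] [e' H2]; apply: funext => w.
have uG : G \in unitmx by rewrite unitmxE unitfE gt_eqF.
pose w0 : 'M[R]_(k + l, n) := castmx (esym e, erefl n) 1%:M.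
have := H1 _ (det_alt (w *m G)^T) w0; rewrite (H2 _ (det_alt (w *m G)^T) w0).
rewrite (eq_irrelevance e' e) !covector_inner_det // trmxK mulmxK //.
suff /mulIf hinj : volume G s (castmx (e, erefl n) w0) != 0 by move/hinj.
rewrite /w0 castmxKV /volume det1 mulr1 mulf_neq0 //.
  by apply: contra_eq_neq ss => ->; rewrite mul0r eq_sym oner_eq0.
by rewrite sqrtr_eq0 -ltNge.
Qed.

(** b is only assumed multilinear: this is what is known of dw and of the twist
    of a form, and what the change of frame in the scalar product requires. *)
Lemma star_comp k l G G' J s s' (b : @covector R n k) :
  s * s = 1 -> s' * s' = 1 -> multilinear b -> J \in unitmx ->
  J *m G' *m J^T = G -> 0 < \det G -> 0 < \det G' ->
  star (l := l) G s (fun u => b (u *m J)) =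
  (fun u => s * s' * Num.sg (\det J) * star G' s' b (u *m J)).
Proof.
move=> ss ss' hb uJ eG dG dG'.
have eG' : invmx J *m G *m (invmx J)^T = G'.
  rewrite -eG trmx_inv !mulmxA mulVmx // mul1mx -mulmxA mulmxV ?mulmx1 //.
  by rewrite unitmx_tr.
pose f (b' : @covector R n l) : @covector R n l :=
  fun u => s * s' * Num.sg (\det J) * b' (u *m J).
rewrite /star (xget_image (f := f) (x0 := 0)
  (P := [set b' | is_alt b' /\ is_hodge G' s' b b'])) //.
- by apply: funext => u; rewrite /f /= mulr0.
- move=> b' [ha hh]; split; first exact/alt_scale/alt_comp.
  by apply: is_hodge_comp hh.
- move=> [b' [ha hh]]; exists (fun u => s' * s * Num.sg (\det (invmx J)) * b' (u *m invmx J)).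
  split; first exact/alt_scale/alt_comp.
  have := is_hodge_comp s' ss _ _ eG' dG hh.
  rewrite unitmx_inv (_ : (fun u => b (u *m invmx J *m J)) = b); last first.
    by apply: funext => u; rewrite mulmxKV.
  by apply=> //; exact: multilinear_comp.
- move=> y z [ya [e hy]] [za [e' hz]]; apply: (star_unique e) => // a ha w.
  by rewrite hy // hz // (eq_irrelevance e e').
Qed.

(** The sign is placed inside the argument, where it meets the sign produced by
    [star_comp] after the exterior derivative. *)
Lemma star_inv_comp k l G G' J s s' (b' : @covector R n l) :
  s * s = 1 -> s' * s' = 1 -> J \in unitmx ->
  J *m G' *m J^T = G -> 0 < \det G -> 0 < \det G' ->
  star_inv (k := k) G s (fun u => s * s' * Num.sg (\det J) * b' (u *m J)) =
  (fun u => star_inv G' s' b' (u *m J)).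
Proof.
move=> ss ss' uJ eG dG dG'.
have eG' : invmx J *m G *m (invmx J)^T = G'.
  rewrite -eG trmx_inv !mulmxA mulVmx // mul1mx -mulmxA mulmxV ?mulmx1 //.
  by rewrite unitmx_tr.
pose f (b : @covector R n k) : @covector R n k := fun u => b (u *m J).
rewrite /star_inv (xget_image (f := f) (x0 := 0)
  (P := [set b | is_alt b /\ is_hodge G' s' b b'])) //.
- move=> b [ha hh]; split; first exact/alt_comp.
  by apply: is_hodge_comp hh => //; exact: is_alt_multilinear.
- move=> [b [ha hh]]; exists (fun u => b (u *m invmx J)).
  split; first exact/alt_comp.
  have := is_hodge_comp s' ss (is_alt_multilinear ha) _ eG' dG hh.
  rewrite unitmx_inv => /(_ uJ).
  set b2 := (X in is_hodge _ _ _ X); suff -> : b2 = b' by [].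
  apply: funext => w; rewrite /b2 mulmxKV // mulrA.
  set t := Num.sg (\det J); set t' := Num.sg _.
  have tt' : t' * t = 1 by rewrite /t' /t -sgrM -det_mulmx mulVmx // det1 sgr1.
  suff -> : s' * s * t' * (s * s' * t) = 1 by rewrite mul1r.
  by transitivity ((s * s) * (s' * s') * (t' * t)); [ring|rewrite ss ss' tt' !mul1r].
- by move=> y z [ya hy] [za hz]; exact: star_inv_unique hy hz.
Qed.

Lemma flat_comp G G' J v : J *m G' *m J^T = G ->
  flat G v = (fun u => flat G' (v *m J) (u *m J)).
Proof.
by move=> <-; apply: funext => u; rewrite /flat trmx_mul !mulmxA.
Qed.

Lemma twist_comp k G G' J v (a : @covector R n k) : J *m G' *m J^T = G ->
  twist G v (fun u => a (u *m J)) = (fun u => twist G' (v *m J) a (u *m J)).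
Proof.
move=> eG; case: k a => [|k] a //; apply: funext => w /=; congr (_ + _).
rewrite (flat_comp v eG) -ext_prod_comp; congr (ext_prod _ _ _).
by apply: funext => u; rewrite /int_prod; congr a; exact: (@mul_col_mx R 1 k).
Qed.

(** The contraction rule for v^flat /\ (iota_v a) evaluated on v and u: the terms
    where v is not in the first place vanish, since a would contain v twice. *)
Lemma ext_prod_flat k G v (a : @covector R n k.+1) (u : 'M[R]_(k, n)) :
  is_alt a ->
  ext_prod (flat G v) (int_prod v a) (col_mx v u) =
  (1`! * k`!)%:R^-1 * shuffle_count 1 k * flat G v v * int_prod v a u.
Proof.
move=> ha; rewrite /ext_prod -!mulrA; congr (_ * _).
rewrite big_distrl /=; apply: eq_bigr => s _; rewrite -!mulrA; congr (_ * _).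
set Q := perm_mx s : 'M[R]_(1 + k).
rewrite row_permE -/Q -[Q in usubmx (Q *m _)]submxK -[Q in dsubmx (Q *m _)]submxK.
rewrite !mul_block_col col_mxKu col_mxKd.
have -> : int_prod v a (dlsubmx Q *m v + drsubmx Q *m u) =
          \det (drsubmx Q) * int_prod v a u.
  rewrite /int_prod -[\det _]mul1r -(det1 R 1) -(det_lblock _ (dlsubmx Q)).
  have e : block_mx 1%:M 0 (dlsubmx Q) (drsubmx Q) *m col_mx v u =
           col_mx v (dlsubmx Q *m v + drsubmx Q *m u).
    by rewrite mul_block_col mul1mx mul0mx addr0.
  by rewrite -(alt_mul_det _ _ ha); exact: (congr1 a (esym e)).
case: (eqVneq (\det (drsubmx Q)) 0) => [->|dr]; first by rewrite !(mul0r, mulr0).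
case: (@perm_mx_block R 1 k s); first by rewrite dr orbT.
rewrite -/Q => -> _; rewrite mul0mx addr0.
rewrite [ulsubmx Q]mx11_scalar mul_scalar_mx det_scalar1 /flat linearZ /=.
by rewrite -scalemxAr mxE; ring.
Qed.

(** Contracting T_v a with v multiplies iota_v a by 1 + c |v|^2 with c >= 0; so
    T_v a determines iota_v a, and then a. *)
Lemma twist_inj k G v (a1 a2 : @covector R n k) :
  0 <= flat G v v -> is_alt a1 -> is_alt a2 -> twist G v a1 = twist G v a2 ->
  a1 = a2.
Proof.
move=> fv; case: k a1 a2 => [|k] a1 a2 // h1 h2 e.
suff ei : int_prod v a1 = int_prod v a2.
  apply: funext => w; have /(congr1 (fun f => f w)) /= := e.
  by rewrite ei => /addIr.
apply: funext => u; have /(congr1 (fun f => f (col_mx v u))) /= := e.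
rewrite !ext_prod_flat // -[a1 _]/(int_prod v a1 u) -[a2 _]/(int_prod v a2 u).
set c := _^-1 * _ * _; rewrite -[X in X + _ = _]mul1r -[X in _ = X + _]mul1r -!mulrDl.
apply: mulfI; rewrite gt_eqF // ltr_pwDl // mulr_ge0 // mulr_ge0 ?invr_ge0 //.
exact/ltW/shuffle_count_gt0.
Qed.

Lemma twist_inv_comp k G G' J v (b : @covector R n k) :
  0 <= flat G v v -> J \in unitmx -> J *m G' *m J^T = G ->
  twist_inv G v (fun u => b (u *m J)) = (fun u => twist_inv G' (v *m J) b (u *m J)).
Proof.
move=> fv uJ eG.
have eG' : invmx J *m G *m (invmx J)^T = G'.
  rewrite -eG trmx_inv !mulmxA mulVmx // mul1mx -mulmxA mulmxV ?mulmx1 //.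
  by rewrite unitmx_tr.
pose f (b : @covector R n k) : @covector R n k := fun u => b (u *m J).
rewrite /twist_inv (xget_image (f := f) (x0 := 0)
  (P := [set a | is_alt a /\ twist G' (v *m J) a = b])) //.
- by move=> a [ha <-]; split; [exact: alt_comp|exact: twist_comp].
- move=> [a [ha ab]]; exists (fun u => a (u *m invmx J)).
  split; first exact: alt_comp.
  rewrite (twist_comp _ _ eG') mulmxK // ab.
  by apply: funext => u; rewrite mulmxKV.
- by move=> y z [ya ey] [za ez]; apply: (twist_inj fv) => //; rewrite ey.
Qed.

Lemma ext_prod_multilinear k l (a : @covector R n k) (b : @covector R n l) :
  multilinear a -> multilinear b -> multilinear (ext_prod a b).
Proof.
move=> ha hb A B C i p q e hB hC; rewrite /ext_prod !big_distrr /= -big_split /=.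
apply: eq_bigr => s _; set sg := (-1) ^+ s; set c := _^-1.
have lin1 x y z : c * (sg * (p * x + q * y) * z) =
    p * (c * (sg * x * z)) + q * (c * (sg * y * z)).
  by clearbody sg c; ring.
have lin2 x y z : c * (sg * z * (p * x + q * y)) =
    p * (c * (sg * z * x)) + q * (c * (sg * z * y)).
  by clearbody sg c; ring.
have rE (X : 'M[R]_(k + l, n)) r : row r (row_perm s X) = row (s r) X.
  by rewrite row_permEsub row_rowsub.
have ruE (X : 'M[R]_(k + l, n)) r : row r (usubmx X) = row (lshift l r) X.
  by rewrite usubmxEsub row_rowsub.
have rdE (X : 'M[R]_(k + l, n)) r : row r (dsubmx X) = row (rshift k r) X.
  by rewrite dsubmxEsub row_rowsub.
have [r ei|r ei] := split_ordP (s^-1%g i).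
  have si : s (lshift l r) = i by rewrite -ei permKV.
  rewrite (ha (usubmx (row_perm s A)) (usubmx (row_perm s B)) (usubmx (row_perm s C)) r p q).
  - have dE (X : 'M[R]_(k + l, n)) : (forall r, r != i -> row r X = row r A) ->
        dsubmx (row_perm s X) = dsubmx (row_perm s A).
      move=> hX; apply/row_matrixP => t; rewrite !rdE !rE hX // -si.
      by rewrite (inj_eq perm_inj) eq_rlshift.
    by rewrite (dE B) // (dE C) // -/sg; exact: lin1.
  - by rewrite !ruE !rE si.
  - by move=> t tr; rewrite !ruE !rE hB // -si (inj_eq perm_inj) (inj_eq (@lshift_inj _ _)).
  - by move=> t tr; rewrite !ruE !rE hC // -si (inj_eq perm_inj) (inj_eq (@lshift_inj _ _)).
have si : s (rshift k r) = i by rewrite -ei permKV.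
rewrite (hb (dsubmx (row_perm s A)) (dsubmx (row_perm s B)) (dsubmx (row_perm s C)) r p q).
- have uE (X : 'M[R]_(k + l, n)) : (forall r, r != i -> row r X = row r A) ->
      usubmx (row_perm s X) = usubmx (row_perm s A).
    move=> hX; apply/row_matrixP => t; rewrite !ruE !rE hX // -si.
    by rewrite (inj_eq perm_inj) eq_lrshift.
  by rewrite (uE B) // (uE C) // -/sg; exact: lin2.
- by rewrite !rdE !rE si.
- by move=> t tr; rewrite !rdE !rE hB // -si (inj_eq perm_inj) (inj_eq (@rshift_inj _ _)).
- by move=> t tr; rewrite !rdE !rE hC // -si (inj_eq perm_inj) (inj_eq (@rshift_inj _ _)).
Qed.

Lemma twist_multilinear k G v (a : @covector R n k) :
  multilinear a -> multilinear (twist G v a).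
Proof.
case: k a => [|k] a //= ha A B C i p q e hB hC.
have hf : multilinear (flat G v).
  move=> A' B' C' j p' q' e' _ _; rewrite /flat.
  move: e'; rewrite ord1 !row_id => ->.
  by rewrite linearD !linearZ /= mulmxDr -!scalemxAr !mxE.
have he := ext_prod_multilinear hf (int_prod_multilinear v ha).
by rewrite (ha A B C i p q) // (he A B C i p q) //; ring.
Qed.

End Natural.

(** * Functions of class C^m on open sets *)

Section Calculus.
Context {R : realType}.

Lemma near_eq_differentiable (V W : normedModType R) (f g : V -> W) (x : V) :
  (\forall y \near x, f y = g y) -> differentiable f x -> differentiable g x.
Proof.
move=> fg /diff_locallyP [dc de].
have gx : f x = g x := nbhs_singleton fg.
have fg0 : \forall h \near (0 : V), f (h + x) = g (h + x).
  by move: fg; rewrite (near_shift 0) subr0.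
have ge : g \o shift x = cst (g x) + 'd f x +o_ 0 id.
  apply/eqaddoP => e e0; move/eqaddoP: de => /(_ e e0) de; near=> h.
  have -> : (g \o shift x - (cst (g x) + 'd f x)) h =
            (f \o shift x - (cst (f x) + 'd f x)) h.
    by rewrite !fctE /= gx; congr (_ - _); apply/esym; near: h.
  by near: h.
have dg := diff_unique dc ge.
by apply/diff_locallyP; rewrite dg.
Unshelve. all: by end_near. Qed.

Section CnOn.
Context {E : normedModType R}.
Implicit Types (U : set E).

Lemma Cn_on_subset (V : normedModType R) m U W (f : E -> V) :
  W `<=` U -> Cn_on m U f -> Cn_on m W f.
Proof.
move=> WU; elim: m f => [|m IH] f /=; first by move=> h x /WU; exact: h.
by move=> [h1 h2]; split=> [x /WU|v]; [exact: h1|exact: IH].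
Qed.

Lemma Cn_on_local (V : normedModType R) m U (f : E -> V) :
  (forall x, U x -> exists W, W x /\ Cn_on m W f) -> Cn_on m U f.
Proof.
elim: m f => [|m IH] f /= h; first by move=> x /h [W [Wx hW]]; exact: hW.
split=> [x /h [W [Wx [hW _]]]|v]; first exact: hW.
by apply: IH => x /h [W [Wx [_ hW]]]; exists W.
Qed.

Lemma open_near_eq (V : Type) U (f g : E -> V) x : open U ->
  (forall x, U x -> f x = g x) -> U x -> \forall y \near x, f y = g y.
Proof. by move=> oU fg Ux; apply: filterS (open_nbhs_nbhs (conj oU Ux)). Qed.

Lemma Cn_on_ext (V : normedModType R) m U (f g : E -> V) : open U ->
  (forall x, U x -> f x = g x) -> Cn_on m U f -> Cn_on m U g.
Proof.
move=> oU; elim: m f g => [|m IH] f g /= fg h.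
  move=> x Ux; have fx := h x Ux.
  change (g @ x --> g x); rewrite -(fg x Ux); apply: cvg_trans fx.
  apply: near_eq_cvg; exact: open_near_eq Ux.
case: h => h1 h2; split=> [x Ux|v].
  by apply: near_eq_differentiable (h1 x Ux); exact: open_near_eq Ux.
apply: IH (h2 v) => x Ux; apply: near_eq_derive; exact: open_near_eq Ux.
Qed.

Lemma Cn_onS (V : normedModType R) m U (f : E -> V) :
  Cn_on m.+1 U f -> Cn_on m U f.
Proof.
elim: m f => [|m IH] f /= [h1 h2].
  by move=> x /h1 /differentiable_continuous.
by split=> // v; apply: IH.
Qed.

Lemma Cn_on_cst (V : normedModType R) m U (c : V) : Cn_on m U (fun=> c).
Proof.
elim: m c => [|m IH] c /=; first by move=> x _; exact: cst_continuous.
split=> [x _|v]; first exact: differentiable_cst.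
by under eq_fun do rewrite derive_cst; exact: IH.
Qed.

Lemma Cn_onD (V : normedModType R) m U (f g : E -> V) : open U ->
  Cn_on m U f -> Cn_on m U g -> Cn_on m U (fun x => f x + g x).
Proof.
move=> oU; elim: m f g => [|m IH] f g /= hf hg.
  by move=> x Ux; apply: continuousD; [exact: hf|exact: hg].
case: hf hg => f1 f2 [g1 g2]; split=> [x Ux|v].
  by apply: differentiableD; [exact: f1|exact: g1].
apply: (@Cn_on_ext _ m _ (fun x => 'D_v f x + 'D_v g x) _ oU); last exact: IH.
move=> x Ux; rewrite [RHS]deriveD //; apply: diff_derivable; [exact: f1|exact: g1].
Qed.

Lemma Cn_onM m U (f g : E -> R^o) : open U ->
  Cn_on m U f -> Cn_on m U g -> Cn_on m U (fun x => f x * g x : R^o).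
Proof.
move=> oU; elim: m f g => [|m IH] f g hf hg.
  by move=> x Ux; apply: continuousM; [exact: hf|exact: hg].
have hf' := Cn_onS hf; have hg' := Cn_onS hg.
case: hf hg => f1 f2 [g1 g2]; split=> [x Ux|v].
  by apply: differentiableM; [exact: (f1 x Ux)|exact: (g1 x Ux)].
apply: (@Cn_on_ext _ m _ (fun x => f x * 'D_v g x + g x * 'D_v f x) _ oU).
  by move=> x Ux; rewrite [RHS]deriveM //; apply: diff_derivable;
    [exact: (f1 x Ux)|exact: (g1 x Ux)].
by apply: Cn_onD => //; [exact: IH hf' (g2 v)|exact: IH hg' (f2 v)].
Qed.

Lemma Cn_on_sum m U (I : Type) (s : seq I) (P : pred I) (f : I -> E -> R^o) :
  open U -> (forall i, Cn_on m U (f i)) ->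
  Cn_on m U (fun x => \sum_(i <- s | P i) f i x : R^o).
Proof.
move=> oU hf; elim: s => [|i s IH].
  by under eq_fun do rewrite big_nil; exact: Cn_on_cst.
under eq_fun do rewrite big_cons; case: (P i) => //.
exact: Cn_onD.
Qed.

Lemma Cn_on_prod m U (I : Type) (s : seq I) (P : pred I) (f : I -> E -> R^o) :
  open U -> (forall i, Cn_on m U (f i)) ->
  Cn_on m U (fun x => \prod_(i <- s | P i) f i x : R^o).
Proof.
move=> oU hf; elim: s => [|i s IH].
  by under eq_fun do rewrite big_nil; exact: Cn_on_cst.
under eq_fun do rewrite big_cons; case: (P i) => //.
exact: Cn_onM.
Qed.

Lemma Cn_on_coord m U p q (F : E -> 'M[R]_(p, q)) i j : open U ->
  Cn_on m U F -> Cn_on m U (fun x => F x i j : R^o).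
Proof.
move=> oU; elim: m F => [|m IH] F hF.
  move=> x Ux; apply: (@continuous_comp _ _ _ F (fun M : 'M[R]_(p, q) => M i j)).
    exact: hF.
  exact: coord_continuous.
case: hF => F1 F2; split=> [x Ux|v].
  apply: (@differentiable_comp _ _ _ _ F (fun M : 'M[R]_(p, q) => M i j : R^o)).
    exact: F1.
  exact: differentiable_coord.
apply: Cn_on_ext (IH _ (F2 v)) => // x Ux.
by rewrite derive_mx ?mxE //; apply: diff_derivable; exact: F1.
Qed.

Lemma derive_comp (V W : normedModType R) (f : V -> W) (F : E -> V) x v :
  differentiable F x -> differentiable f (F x) ->
  'D_v (f \o F) x = 'D_('D_v F x) f (F x).
Proof.
move=> dF df; rewrite deriveE; last exact: differentiable_comp.
by rewrite diff_comp //= !deriveE.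
Qed.

Lemma derive_rV n (f : 'rV[R]_n -> R^o) y v : differentiable f y ->
  'D_v f y = \sum_i v 0 i * 'D_(delta_mx 0 i) f y.
Proof.
move=> df; rewrite deriveE // {1}(row_sum_delta v) linear_sum.
by apply: eq_bigr => i _; rewrite linearZ deriveE.
Qed.

(** The derivative of f o F along v is the sum of the products
    of the coordinates of D_v F by the partial derivatives of f composed with F. *)
Lemma Cn_on_comp n m U W (f : 'rV[R]_n -> R^o) (F : E -> 'rV[R]_n) : open U ->
  (forall x, U x -> W (F x)) -> Cn_on m W f -> Cn_on m U F ->
  Cn_on m U (f \o F).
Proof.
move=> oU UW; elim: m f => [|m IH] f hf hF.
  by move=> x Ux; apply: continuous_comp; [exact: hF|apply: hf; exact: UW].
have hF' := Cn_onS hF; case: hf hF => f1 f2 [F1 F2]; split=> [x Ux|v].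
  by apply: differentiable_comp; [exact: F1|apply: f1; exact: UW].
apply: (@Cn_on_ext _ m _
  (fun x => \sum_i ('D_v F x) 0 i * ('D_(delta_mx 0 i) f \o F) x : R^o) _ oU).
  move=> x Ux; rewrite [RHS]derive_comp; [|exact: F1|apply: f1; exact: UW].
  by rewrite derive_rV //; apply: f1; exact: UW.
apply: Cn_on_sum => // i; apply: Cn_onM => //; first exact: Cn_on_coord (F2 v).
exact: IH (f2 _) hF'.
Qed.

End CnOn.
End Calculus.

(** * Symmetry of second derivatives *)

Section SecondDerivatives.
Context {R : realType} {E : normedModType R}.

Lemma is_derive_line (f : E -> R^o) a v (t : R) : derivable f (t *: v + a) v ->
  is_derive t (1 : R) (fun s : R => f (s *: v + a) : R^o) ('D_v f (t *: v + a)).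
Proof.
have e : (fun h : R => h^-1 *: (((fun s : R => f (s *: v + a)) \o shift t) (h *: 1) -
                     f (t *: v + a))) =
         (fun h : R => h^-1 *: ((f \o shift (t *: v + a)) (h *: v) - f (t *: v + a))).
  by apply: funext => h /=; rewrite [h *: 1]mulr1 scalerDl addrA.
move=> dv; apply: DeriveDef; first by rewrite /derivable e.
by rewrite /derive e.
Qed.

Lemma MVT_line (f : E -> R^o) a v (t : R) : 0 < t ->
  (forall s, 0 <= s <= t -> derivable f (s *: v + a) v) ->
  exists2 c, 0 < c < t & f (t *: v + a) - f a = 'D_v f (c *: v + a) * t.
Proof.
move=> t0 df.
have d x : x \in `]0, t[ -> is_derive x (1 : R) (fun s => f (s *: v + a) : R^o)
    ('D_v f (x *: v + a)).
  rewrite in_itv /= => /andP[/ltW x0 /ltW xt].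
  by apply: is_derive_line; apply: df; rewrite x0.
have dc : {within `[0, t], continuous (fun s => f (s *: v + a) : R^o)}.
  apply: derivable_within_continuous => x; rewrite in_itv /= => xt.
  by have [] := is_derive_line (df _ xt).
have [c ct] := MVT t0 d dc.
by rewrite scale0r add0r subr0 => e; exists c => //; move: ct; rewrite in_itv.
Qed.

(** The mean value theorem, applied to the difference of two parallel segments
    in direction u, and then to D_u f in direction v. *)
Lemma second_difference (f : E -> R^o) a u v (t : R) : 0 < t ->
  (forall s r, 0 <= s <= t -> 0 <= r <= t ->
     derivable f (s *: u + (r *: v + a)) u /\
     derivable ('D_u f) (r *: v + (s *: u + a)) v) ->
  exists s r, [/\ 0 <= s <= t, 0 <= r <= t &
    f (t *: u + (t *: v + a)) - f (t *: u + a) - (f (t *: v + a) - f a) =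
    'D_v ('D_u f) (r *: v + (s *: u + a)) * t * t].
Proof.
move=> t0 h.
have tt : 0 <= t <= t by rewrite lexx ltW.
have t00 : 0 <= (0 : R) <= t by rewrite lexx ltW.
pose phi x : R^o := f (t *: v + x) - f x.
have dphi s : 0 <= s <= t -> is_derive (s *: u + a) u phi
    ('D_u f (t *: v + (s *: u + a)) - 'D_u f (s *: u + a)).
  move=> st; apply: is_deriveB; last first.
    by apply: derivableP; have [+ _] := h s 0 st t00; rewrite scale0r add0r.
  have e : (fun k : R => k^-1 *: (((fun x => f (t *: v + x)) \o shift (s *: u + a)) (k *: u) -
             f (t *: v + (s *: u + a)))) =
     (fun k : R => k^-1 *: ((f \o shift (t *: v + (s *: u + a))) (k *: u) -
             f (t *: v + (s *: u + a)))).
    by apply: funext => k /=; rewrite [t *: v + (k *: u + _)]addrCA.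
  have [+ _] := h s t st tt; rewrite addrCA => df.
  by apply: DeriveDef; rewrite /derivable /derive e.
have dphi1 s : 0 <= s <= t -> derivable phi (s *: u + a) u by case/dphi.
have [s st e1] := MVT_line t0 dphi1.
have {}st : 0 <= s <= t by case/andP: st => /ltW -> /ltW.
have [r rt e2] := MVT_line t0 (fun r rt => (h s r st rt).2).
have {}rt : 0 <= r <= t by case/andP: rt => /ltW -> /ltW.
exists s, r; split=> //.
have [_ dphiE] := dphi s st.
by move: e1; rewrite dphiE e2 => <-; rewrite /phi [t *: v + (_ + _)]addrCA; ring.
Qed.

(** Schwarz's theorem.  The second difference over a small parallelogram is
    symmetric in u and v, and equals t^2 times either of the mixed derivatives at
    some point of it; the continuity of these concludes. *)
Lemma derive_symmetric (f : E -> R^o) (U : set E) y u v : open U -> U y -> Cn_on 2 U f ->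
  'D_u ('D_v f) y = 'D_v ('D_u f) y.
Proof.
move=> oU Uy [d1 h]; have [du cu] := h u; have [dv cv] := h v.
(* From here on G1 and G2 are just two functions continuous at y, whose values
   are met through the second differences only. *)
suff main (G1 G2 : E -> R^o) : G1 = 'D_u ('D_v f) -> G2 = 'D_v ('D_u f) ->
  G1 y = G2 y by exact: (main _ _ erefl erefl).
move=> E1 E2.
have c1 : {for y, continuous G1} by rewrite E1; exact: (cv u y Uy).
have c2 : {for y, continuous G2} by rewrite E2; exact: (cu v y Uy).
apply/eqP; rewrite -subr_eq0 -normr_le0; apply/ler_addgt0Pr => e e0.
rewrite add0r.
have e2 : 0 < e / 2 by rewrite divr_gt0.
have near_y (G : E -> R^o) : {for y, continuous G} ->
    \forall z \near y, `|G y - G z| < e / 2.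
  by move=> /cvgrPdist_lt; apply.
have n1 : \forall z \near y, U z := open_nbhs_nbhs (conj oU Uy).
have [d /= d0 hd] := (nbhs_ballP _ _).1
  (filterI n1 (filterI (near_y _ c1) (near_y _ c2))).
(* The parallelogram with sides t u and t v lies in the ball of radius d. *)
pose t := d / 2 / (`|u| + `|v| + 1).
have uv0 : 0 < `|u| + `|v| + 1 by rewrite ltr_wpDl ?addr_ge0.
have t0 : 0 < t by rewrite !divr_gt0.
have small s r : 0 <= s <= t -> 0 <= r <= t -> ball y d (s *: u + (r *: v + y)).
  move=> /andP[s0 st] /andP[r0 rt]; rewrite -ball_normE /= distrC addrA addrK.
  apply: le_lt_trans (ler_normD _ _) _; rewrite !normrZ !ger0_norm //.
  apply: (@le_lt_trans _ _ (t * (`|u| + `|v| + 1))).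
    rewrite !mulrDr mulr1 -addrA lerD ?ler_wpM2r // ler_wpDr ?ler_wpM2r //.
    exact: ltW.
  by rewrite divfK ?gt_eqF // ltr_pdivrMr // ltr_pMr // ltr1n.
have d12 s r : 0 <= s <= t -> 0 <= r <= t ->
    derivable f (s *: u + (r *: v + y)) u /\
    derivable ('D_u f) (r *: v + (s *: u + y)) v.
  move=> st rt; have [Uz _] := hd _ (small s r st rt).
  by split; apply: diff_derivable; [exact: d1|rewrite addrCA; exact: du].
have d21 s r : 0 <= s <= t -> 0 <= r <= t ->
    derivable f (s *: v + (r *: u + y)) v /\
    derivable ('D_v f) (r *: u + (s *: v + y)) u.
  move=> st rt; have [Uz _] := hd _ (small r s rt st).
  by split; apply: diff_derivable; [rewrite addrCA; exact: d1|exact: dv].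
have [s [r [st rt e1]]] : exists s r, [/\ 0 <= s <= t, 0 <= r <= t &
    f (t *: u + (t *: v + y)) - f (t *: u + y) - (f (t *: v + y) - f y) =
    G2 (r *: v + (s *: u + y)) * t * t].
  by rewrite E2; exact: second_difference t0 d12.
have [s' [r' [st' rt' e3]]] : exists s r, [/\ 0 <= s <= t, 0 <= r <= t &
    f (t *: v + (t *: u + y)) - f (t *: v + y) - (f (t *: u + y) - f y) =
    G1 (r *: u + (s *: v + y)) * t * t].
  by rewrite E1; exact: second_difference t0 d21.
clear E1 E2 d12 d21.
have [_ [_ h2]] := hd _ (small s r st rt).
have [_ [h1 _]] := hd _ (small r' s' rt' st').
have e4 : G2 (r *: v + (s *: u + y)) = G1 (r' *: u + (s' *: v + y)).
  apply: (@mulIf _ t); rewrite ?gt_eqF //; apply: (@mulIf _ t); rewrite ?gt_eqF //.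
  by rewrite -e1 -e3 [t *: u + (t *: v + y)]addrCA; ring.
move: h1 h2; rewrite [s *: u + (r *: v + y)]addrCA /= -e4 => h1 h2.
rewrite [e]splitr; apply: ltW; apply: le_lt_trans (ltrD h1 h2).
rewrite [X in _ <= _ + X]distrC; apply: le_trans (ler_normD _ _).
by rewrite subrKA.
Qed.

End SecondDerivatives.

(** * Derivatives of products and of multilinear expressions *)

Section Product.
Context {R : realType} {E : normedModType R}.

Lemma is_derive_bigsum (x v : E) (I : Type) (s : seq I) (P : pred I)
    (h : I -> E -> R^o) (dh : I -> R^o) :
  (forall i, is_derive x v (h i) (dh i)) ->
  is_derive x v (fun z => \sum_(i <- s | P i) h i z : R^o) (\sum_(i <- s | P i) dh i).
Proof.
move=> hd; elim: s => [|i s IH].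
  by rewrite big_nil; under eq_fun do rewrite big_nil; exact: is_derive_cst.
rewrite big_cons; under eq_fun do rewrite big_cons; case: (P i) => //.
exact: is_deriveD.
Qed.

End Product.

Section FormDerivative.
Context {R : realType} {E : normedModType R}.

Lemma is_derive_prod (x v : E) k (h : 'I_k -> E -> R^o) (dh : 'I_k -> R^o) :
  (forall i, is_derive x v (h i) (dh i)) ->
  is_derive x v (fun z => \prod_i h i z : R^o)
    (\sum_r \prod_i (if i == r then dh i else h i x)).
Proof.
elim: k h dh => [|k IH] h dh hd.
  by rewrite big_ord0; under eq_fun do rewrite big_ord0; exact: is_derive_cst.
under eq_fun do rewrite big_ord_recl.
have := is_deriveM (hd ord0) (IH _ _ (fun i => hd (lift ord0 i))).
rewrite addrC; congr is_derive.
rewrite big_ord_recl big_ord_recl /=; congr (_ + _).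
  by rewrite mulrC; congr (_ * _); apply: eq_bigr.
rewrite [LHS]mulr_sumr; apply: eq_bigr => r _.
rewrite big_ord_recl /=; by congr (_ * _); apply: eq_bigr => i _; rewrite (inj_eq lift_inj).
Qed.

Definition set_row m p (A : 'M[R]_(m, p)) (r : 'I_m) (x : 'rV[R]_p) : 'M[R]_(m, p) :=
  \matrix_t (if t == r then x else row t A).

(** Leibniz rule for the evaluation of a field of multilinear maps on moving
    vectors: one term for W and one for each row of A. *)
Lemma derive_form n k (F : E -> 'rV[R]_n) (A : E -> 'M[R]_(k, n))
    (W : 'rV[R]_n -> @covector R n k) (V : set 'rV[R]_n) y v d :
  differentiable F y -> 'D_v F y = d -> (forall r c, derivable (fun z => A z r c : R^o) y v) ->
  open V -> V (F y) -> (forall z, V z -> multilinear (W z)) ->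
  (forall u, differentiable (fun z => W z u : R^o) (F y)) ->
  'D_v (fun z => W (F z) (A z) : R^o) y =
  'D_d (fun z => W z (A y) : R^o) (F y) +
  \sum_r W (F y) (set_row (A y) r (\row_c 'D_v (fun z => A z r c : R^o) y)).
Proof.
move=> dF <- dA oV Vy hW dW.
pose e (f : {ffun 'I_k -> 'I_n}) : 'M[R]_(k, n) := rowsub f 1%:M.
have WE z B : V z -> W z B = \sum_(f : {ffun 'I_k -> 'I_n}) (\prod_r B r (f r)) * W z (e f).
  by move=> Vz; rewrite -[B in LHS]mulmx1 multilinear_mul //; exact: hW.
have nV : \forall z \near y, V (F z).
  by apply: (differentiable_continuous dF); exact: open_nbhs_nbhs.
rewrite (@near_eq_derive _ _ _ _
    (fun z => \sum_(f : {ffun 'I_k -> 'I_n})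
       (\prod_r A z r (f r)) * W (F z) (e f) : R^o)); last first.
  by apply: filterS nV => z; exact: WE.
rewrite (@near_eq_derive _ _ _ (fun z => W z (A y) : R^o)
    (fun z => \sum_(f : {ffun 'I_k -> 'I_n}) (\prod_r A y r (f r)) * W z (e f) : R^o)); last first.
  by apply: filterS (open_nbhs_nbhs (conj oV Vy)) => z; exact: WE.
have d1 f : is_derive (F y) ('D_v F y) (fun z => W z (e f) : R^o)
    ('D_('D_v F y) (fun z => W z (e f) : R^o) (F y)).
  exact/derivableP/diff_derivable.
have d2 f : is_derive y v (fun z => W (F z) (e f) : R^o)
    ('D_('D_v F y) (fun z => W z (e f) : R^o) (F y)).
  rewrite -(derive_comp v dF (dW (e f))); apply: derivableP.
  by apply: diff_derivable; exact: (differentiable_comp dF (dW (e f))).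
have d3 (f : {ffun 'I_k -> 'I_n}) :=
  is_derive_prod (fun r => derivableP (dA r (f r))).
have [_ ->] := is_derive_bigsum (index_enum _) xpredT (fun f => is_deriveM (d3 f) (d2 f)).
have [_ ->] := is_derive_bigsum (index_enum _) xpredT
  (fun f : {ffun 'I_k -> 'I_n} => is_deriveZ (\prod_r A y r (f r)) (d1 f)).
rewrite big_split /=; congr (_ + _).
under [RHS]eq_bigr => r _ do rewrite WE //.
rewrite exchange_big /=; apply: eq_bigr => f _.
rewrite [LHS]mulrC -mulr_suml; congr (_ * _); apply: eq_bigr => r _.
by apply: eq_bigr => i _; rewrite !mxE; case: eqP => [->|_]; rewrite !mxE.
Qed.

End FormDerivative.

(** * The exterior derivative on R^n commutes with pullback *)

Section ExteriorDerivative.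
Context {R : realType} {n : nat}.

(** The exterior derivative on R^n; [ext_deriv] is its value in the preferred
    chart. *)
Definition ext_d k (W : 'rV[R]_n -> @covector R n k) (y : 'rV[R]_n) : @covector R n k.+1 :=
  fun u => \sum_(i < k.+1)
    (-1) ^+ i * 'D_(row i u) (fun z => W z (row' i u) : R^o) y.

Lemma set_row_row' k p (X : 'M[R]_(k.+1, p)) i r x :
  row' i (set_row X (lift i r) x) = set_row (row' i X) r x.
Proof.
apply/matrixP => t c; rewrite !mxE (inj_eq lift_inj).
by case: eqP => _ //; rewrite !mxE.
Qed.

Lemma row'_set_row k p (X : 'M[R]_(k.+1, p)) i x :
  row' i (set_row X i x) = row' i X.
Proof. by apply/matrixP => t c; rewrite !mxE eq_sym (negPf (neq_lift _ _)) mxE. Qed.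

(** The terms of (i, j) and (j, i) come from one matrix in which rows i and j are
    both equal to b i j, with row i, resp. row j, deleted; they are opposite by
    [alt_row'_eq]. *)
Lemma alt_symmetric_cancel k (a : @covector R n k) (X : 'M[R]_(k.+1, n))
    (b : 'I_k.+1 -> 'I_k.+1 -> 'rV[R]_n) :
  is_alt a -> (forall i j, b i j = b j i) ->
  \sum_(i < k.+1) \sum_(r < k)
    (-1) ^+ i * a (set_row (row' i X) r (b i (lift i r))) = 0.
Proof.
move=> ha bC.
pose T (i j : 'I_k.+1) : R := (-1) ^+ i * a (row' i (set_row X j (b i j))).
have TT i j : i != j -> T i j + T j i = 0.
  move=> ij; pose x := set_row (set_row X i (b i j)) j (b i j).
  have xi : row i x = b i j by rewrite /x /set_row !rowK (negPf ij) eqxx.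
  have xj : row j x = b i j by rewrite /x /set_row !rowK eqxx.
  have := alt_row'_eq ha ij (etrans xi (esym xj)); rewrite -[RHS]/0 => <-.
  rewrite /T [b j i]bC /x row'_set_row; congr (_ * a _ + _).
  apply/matrixP => t c; rewrite !mxE; case: eqP => // _.
  by rewrite !mxE eq_sym (negPf (neq_lift _ _)) mxE.
have SE : \sum_(i < k.+1) \sum_(r < k)
    (-1) ^+ i * a (set_row (row' i X) r (b i (lift i r))) =
    \sum_i \sum_(j | j != i) T i j.
  apply: eq_bigr => i _; rewrite [RHS](reindex_omap (lift i) (unlift i)) /=.
    apply: eq_big => [r|r _]; first by rewrite liftK eq_sym eqxx neq_lift.
    by rewrite /T set_row_row'.
  by move=> j; case: unliftP => [r ->|->]; rewrite ?eqxx.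
rewrite SE; suff /eqP : (\sum_i \sum_(j | j != i) T i j) *+ 2 = 0.
  by rewrite mulrn_eq0 => /eqP.
rewrite mulr2n.
rewrite [X in X + _](exchange_big_dep xpredT) //= -big_split /= big1 // => i _.
under eq_bigl do rewrite eq_sym.
by rewrite -big_split /= big1 // => j ji; rewrite TT.
Qed.

(** J is an arbitrary matrix-valued function that agrees with the Jacobian of F
    on U, so that the chart Jacobians of a map between manifolds fit. *)
Lemma ext_d_comp k (F : 'rV[R]_n -> 'rV[R]_n) (U V : set 'rV[R]_n)
    (W : 'rV[R]_n -> @covector R n k)
    (J : 'rV[R]_n -> 'M[R]_n) y :
  open U -> U y -> Cn_on 2 U F ->
  (forall v z, U z -> v *m J z = 'D_v F z) -> open V -> V (F y) ->
  (forall z, V z -> is_alt (W z)) ->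
  (forall u, differentiable (fun z => W z u : R^o) (F y)) ->
  ext_d (fun z u => W (F z) (u *m J z)) y =
  (fun u => ext_d W (F y) (u *m J y)).
Proof.
move=> oU Uy CF D1 oV Vy hW dW; apply: funext => u; rewrite /ext_d.
have [dF C1] := CF.
have dDF (v : 'rV[R]_n) c : differentiable (fun z => (v *m J z) 0 c : R^o) y.
  have e : \forall z \near y, ('D_v F z) 0 c = (v *m J z) 0 c :> R^o.
    by apply: (open_near_eq (U := U)) => // z Uz; rewrite D1.
  apply: near_eq_differentiable e _.
  have CD : Cn_on 1 U ('D_v F) := C1 v.
  by have [/(_ y Uy)] := Cn_on_coord 0 c oU CD.
(* b i j is the second derivative of F along the rows i and j of u. *)
pose b i j : 'rV[R]_n :=
  \row_c 'D_(row i u) (fun z => (row j u *m J z) 0 c : R^o) y.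
have bC i j : b i j = b j i.
  apply/rowP => c; rewrite !mxE.
  have e i' j' : 'D_(row i' u) (fun z => (row j' u *m J z) 0 c : R^o) y =
      'D_(row i' u) ('D_(row j' u) (fun z => F z 0 c : R^o)) y.
    apply: near_eq_derive; apply: (open_near_eq (U := U)) => // z Uz.
    by rewrite D1 // derive_mx ?mxE //; apply: diff_derivable; exact: dF.
  rewrite !e; exact: derive_symmetric (Cn_on_coord 0 c oU CF).
have main i : 'D_(row i u) (fun z => W (F z) (row' i u *m J z) : R^o) y =
    'D_(row i (u *m J y))
      (fun z => W z (row' i (u *m J y)) : R^o) (F y) +
    \sum_r W (F y) (set_row (row' i (u *m J y)) r (b i (lift i r))).
  have rE (r : 'I_k) c z :
      (row' i u *m J z) r c = (row (lift i r) u *m J z) 0 c.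
    by rewrite !mxE; apply: eq_bigr => p _; rewrite !mxE.
  have dE : 'D_(row i u) F y = row i (u *m J y) by rewrite row_mul D1.
  have dA r c : derivable (fun z => (row' i u *m J z) r c : R^o) y (row i u).
    by under eq_fun do rewrite rE; exact: diff_derivable.
  have hm z : V z -> multilinear (W z) by move=> /hW; exact: is_alt_multilinear.
  have AE : row' i u *m J y = row' i (u *m J y).
    by rewrite !row'Esub mul_rowsub_mx.
  have dfE := derive_form (dF y Uy) dE dA oV Vy hm dW.
  rewrite AE in dfE; rewrite dfE {dfE}.
  congr (_ + _); apply: eq_bigr => r _; congr (W _ (set_row _ _ _)).
  by apply/rowP => c; rewrite !mxE; under eq_fun do rewrite rE.
under eq_bigr do rewrite main mulrDr mulr_sumr.
by rewrite big_split /= alt_symmetric_cancel ?addr0 //; exact: hW.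
Qed.

Lemma ext_d_near k (W W' : 'rV[R]_n -> @covector R n k) y :
  (forall u, \forall z \near y, W z u = W' z u) -> ext_d W y = ext_d W' y.
Proof.
move=> h; apply: funext => u; apply: eq_bigr => i _; congr (_ * _).
exact: near_eq_derive.
Qed.

Lemma ext_dZ k (W : 'rV[R]_n -> @covector R n k) e y u :
  (forall v, differentiable (fun z => W z v : R^o) y) ->
  ext_d (fun z v => e * W z v) y u = e * ext_d W y u.
Proof.
move=> dW; rewrite /ext_d mulr_sumr; apply: eq_bigr => i _; rewrite mulrCA.
congr (_ * _); apply: etrans (deriveZ _ _) _ => //.
exact: diff_derivable.
Qed.

Lemma ext_d_multilinear k (W : 'rV[R]_n -> @covector R n k) y :
  (forall z, multilinear (W z)) ->
  (forall v, differentiable (fun z => W z v : R^o) y) -> multilinear (ext_d W y).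
Proof.
move=> hW dW B C D i b c e hC hD; rewrite /ext_d !mulr_sumr -big_split /=.
apply: eq_bigr => j _.
have [->|ji] := eqVneq j i.
  have -> : row' i C = row' i B by apply/row'_eqP.
  have -> : row' i D = row' i B by apply/row'_eqP.
  have dB := dW (row' i B).
  rewrite e !deriveE // linearD !linearZ /=.
  set s := (-1) ^+ i; set x := 'd _ _ _; set x' := 'd _ _ _; clearbody s x x'.
  by rewrite /GRing.scale /=; ring.
rewrite (hC j ji) (hD j ji).
have [r er] : exists r, i = lift j r.
  by case: (unliftP j i) => [r ->|ij]; [exists r|rewrite ij eqxx in ji].
have -> : 'D_(row j B) (fun z => W z (row' j B) : R^o) y =
    b * 'D_(row j B) (fun z => W z (row' j C) : R^o) y +
    c * 'D_(row j B) (fun z => W z (row' j D) : R^o) y.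
  have WE : (fun z => W z (row' j B) : R^o) =
      (b \*: (fun z => W z (row' j C) : R^o)) + (c \*: (fun z => W z (row' j D) : R^o)).
    have rE (X : 'M[R]_(k.+1, n)) t : row t (row' j X) = row (lift j t) X.
      by rewrite row'Esub row_rowsub.
    apply: funext => z; apply: (hW z _ _ _ r).
    - by rewrite !rE -er.
    - by move=> t tr; rewrite !rE hC // er (inj_eq lift_inj).
    - by move=> t tr; rewrite !rE hD // er (inj_eq lift_inj).
  have dD v : is_derive y (row j B) (fun z => W z v : R^o)
      ('D_(row j B) (fun z => W z v : R^o) y).
    exact/derivableP/diff_derivable.
  by rewrite WE; have [_ ->] :=
    is_deriveD (is_deriveZ b (dD (row' j C))) (is_deriveZ c (dD (row' j D))).
set s := (-1) ^+ j; set x := derive _ _ _; set x' := derive _ _ _; clearbody s x x'.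
by ring.
Qed.

End ExteriorDerivative.

(** * Positive definite matrices *)

Section PosDef.
Context {R : realType}.

(** Induction on the size by Schur complements: clearing the first column by a
    unipotent L turns G into diag (a, S) with a > 0 and S positive definite. *)
Lemma posdef_det_gt0 n (G : 'M[R]_n) : G^T = G ->
  (forall u : 'rV[R]_n, u != 0 -> 0 < (u *m G *m u^T) 0 0) -> 0 < \det G.
Proof.
elim: n G => [|n IH] G sG pG; first by rewrite det_mx00.
move: G sG pG; rewrite -[n.+1]/(1 + n)%N => G sG pG.
pose a := G (lshift n 0) (lshift n 0); pose x : 'cV[R]_n := dlsubmx G.
have aE : ulsubmx G = a%:M.
  by rewrite [ulsubmx G]mx11_scalar; congr (_%:M); rewrite !mxE.
have urE : ursubmx G = x^T by rewrite -[in LHS]sG /x trmx_dlsub.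
have GE : G = block_mx a%:M x^T x (drsubmx G) by rewrite -urE -aE submxK.
have a0 : 0 < a.
  have /pG : (delta_mx 0 (lshift n 0) : 'rV[R]_(1 + n)) != 0.
    apply/eqP => /matrixP/(_ 0 (lshift n 0)); rewrite !mxE !eqxx => /eqP.
    by rewrite oner_eq0.
  by rewrite -rowE trmx_delta -colE !mxE.
pose L : 'M[R]_(1 + n) := block_mx 1%:M 0 (- a^-1 *: x) 1%:M.
pose S := drsubmx G - a^-1 *: (x *m x^T).
have LG : L *m G *m L^T = block_mx a%:M 0 0 S.
  rewrite GE /L tr_block_mx !mulmx_block !(mul1mx, mulmx1, mul0mx, trmx1, trmx0, mulmx0, addr0).
  have xa : - a^-1 *: x *m a%:M + x = 0.
    by rewrite mul_mx_scalar scalerA mulrN mulfV ?gt_eqF // scaleN1r addNr.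
  have ax : a%:M *m (- a^-1 *: x)^T + x^T = 0.
    by rewrite linearZ /= mul_scalar_mx scalerA mulrN mulfV ?gt_eqF // scaleN1r addNr.
  by rewrite xa ax mul0mx add0r /S addrC -scalemxAl scaleNr.
have dL : \det L = 1 by rewrite det_lblock !det1 mulr1.
have sS : S^T = S.
  by rewrite /S linearB /= linearZ /= trmx_mul trmxK trmx_drsub sG.
have -> : \det G = a * \det S.
  have := congr1 (@determinant R _) LG.
  by rewrite !det_mulmx det_tr dL mul1r mulr1 det_lblock det_scalar1.
rewrite mulr_gt0 // IH // => u u0.
have : row_mx 0 u *m L != 0.
  rewrite mul_row_block !mul0mx mulmx1 add0r; apply: contraNneq u0.
  by move=> /(congr1 rsubmx); rewrite row_mxKr linear0 add0r => ->.
move=> /pG; rewrite trmx_mul !mulmxA -(mulmxA _ L G) -(mulmxA _ (L *m G)) LG.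
by rewrite mul_row_block tr_row_mx !mul0mx !mulmx0 !add0r mul_row_col mul0mx add0r.
Qed.

End PosDef.

(** * Charts and tangent maps *)

Definition local_rep {R : realType} {n : nat} {M : topologicalType}
  (c c' : chart R n M) (Phi : M -> M) : 'rV[R]_n -> 'rV[R]_n :=
  cmap c' \o Phi \o cinv c.

Definition local_dom {R : realType} {n : nat} {M : topologicalType}
  (c c' : chart R n M) (Phi : M -> M) : set 'rV[R]_n :=
  cmap c @` (cdom c `&` Phi @^-1` cdom c').

(** Locked, so that Jacobians in different charts are compared by the lemmas below
    and never by unfolding limits. *)
HB.lock Definition local_jac {R : realType} {n : nat} {M : topologicalType}
  (c c' : chart R n M) (Phi : M -> M) (p : M) : 'M[R]_n :=
  jacobian (local_rep c c' Phi) (cmap c p).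

Section Charts.
Context {R : realType} {n : nat} {M : topologicalType}.
Variable A : smooth_atlas R n M.
Implicit Types (c : chart R n M) (Phi Psi : M -> M) (p : M).

Lemma open_cmap_image c (S : set M) : is_chart c -> open S ->
  open (cmap c @` (cdom c `&` S)).
Proof.
move=> [[od oi] cc ci cK] oS; rewrite openE => y [p [dp Sp] <-].
rewrite /interior.
have yi : (cmap c @` cdom c) (cmap c p) by exists p.
have n1 : nbhs (cmap c p) (cmap c @` cdom c) := open_nbhs_nbhs (conj oi yi).
have n2 : nbhs (cmap c p) (cinv c @^-1` S).
  by apply: (ci _ yi); rewrite cK //; exact: open_nbhs_nbhs.
apply: filterS (filterI n1 n2) => z [[q dq <-]]; rewrite /preimage /= cK // => Sq.
by exists q.
Qed.

Lemma eq_rV_mulmx (m1 m2 : nat) (X Y : 'M[R]_(m1, m2)) :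
  (forall v : 'rV[R]_m1, v *m X = v *m Y) -> X = Y.
Proof. by move=> h; apply/row_matrixP => i; have := h (delta_mx 0 i); rewrite -!rowE. Qed.

Lemma charts_at p : charts A (chart_at A p). Proof. by case: (chart_atP A p). Qed.

Lemma cdom_at p : cdom (chart_at A p) p. Proof. by case: (chart_atP A p). Qed.

Lemma cinvK c p : charts A c -> cdom c p -> cinv c (cmap c p) = p.
Proof. by move=> /chartsP [_ _ _]; apply. Qed.

Lemma open_cdom c : charts A c -> open (cdom c).
Proof. by move=> /chartsP [[]]. Qed.

Lemma open_preimage Phi (S : set M) : continuous Phi -> open S -> open (Phi @^-1` S).
Proof. by move=> /continuousP; apply. Qed.

Lemma open_local_dom c c' Phi : charts A c -> charts A c' -> continuous Phi ->
  open (local_dom c c' Phi).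
Proof.
move=> /chartsP cc /open_cdom oc' cP; apply: open_cmap_image => //.
exact: open_preimage.
Qed.

Lemma smooth_map_id : smooth_map A id.
Proof.
split=> [|c c' cc cc']; first by move=> x; exact: cvg_id.
exact: (transition_smooth cc cc').
Qed.

Lemma local_smooth c c' Phi : smooth_map A Phi -> charts A c -> charts A c' ->
  smooth_on (local_dom c c' Phi) (local_rep c c' Phi).
Proof. by move=> [_ sP] cc cc'; exact: sP. Qed.

Lemma local_differentiable c c' Phi y : smooth_map A Phi -> charts A c ->
  charts A c' -> local_dom c c' Phi y -> differentiable (local_rep c c' Phi) y.
Proof. by move=> sP cc cc'; have [h _] := local_smooth sP cc cc' 1; exact: h. Qed.

Lemma local_domI c c' Phi p : cdom c p -> cdom c' (Phi p) ->
  local_dom c c' Phi (cmap c p).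
Proof. by move=> h h'; exists p. Qed.

Lemma local_repE c c' Phi p : charts A c -> cdom c p ->
  local_rep c c' Phi (cmap c p) = cmap c' (Phi p).
Proof. by move=> cc dp; rewrite /local_rep /= cinvK. Qed.

Lemma mul_local_jac c c' Phi p v : smooth_map A Phi -> charts A c ->
  charts A c' -> cdom c p -> cdom c' (Phi p) ->
  v *m local_jac c c' Phi p = 'D_v (local_rep c c' Phi) (cmap c p).
Proof.
move=> sP cc cc' dp dp'; rewrite local_jac.unlock deriveEjacobian //.
by apply: local_differentiable => //; exact: local_domI.
Qed.

Lemma local_jac_comp c c' c'' Phi Psi p :
  smooth_map A Phi -> smooth_map A Psi -> smooth_map A (Psi \o Phi) ->
  charts A c -> charts A c' -> charts A c'' ->
  cdom c p -> cdom c' (Phi p) -> cdom c'' (Psi (Phi p)) ->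
  local_jac c c'' (Psi \o Phi) p =
  local_jac c c' Phi p *m local_jac c' c'' Psi (Phi p).
Proof.
move=> s1 s2 s12 cc cc' cc'' d d' d''; apply: eq_rV_mulmx => v.
rewrite mulmxA.
rewrite (mul_local_jac _ s12 cc cc'' d d'').
rewrite (mul_local_jac _ s1 cc cc' d d') (mul_local_jac _ s2 cc' cc'' d' d'').
rewrite -(local_repE c' Phi cc d) -derive_comp; first last.
- apply: local_differentiable => //.
  by rewrite local_repE //; exact: local_domI.
- by apply: local_differentiable => //; exact: local_domI.
apply: near_eq_derive; apply: (open_near_eq (U := local_dom c c' Phi)).
- by apply: open_local_dom => //; case: s1.
- move=> z [q [dq dq'] <-]; rewrite /local_rep /=.
  by rewrite (cinvK cc dq) (cinvK cc' dq').
- exact: local_domI.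
Qed.

Lemma local_jac_id c p : charts A c -> cdom c p -> local_jac c c id p = 1%:M.
Proof.
move=> cc d; apply: eq_rV_mulmx => v.
rewrite mulmx1 (mul_local_jac _ smooth_map_id cc cc d d).
rewrite -[RHS](@derive_id _ _ (cmap c p)); apply: near_eq_derive.
apply: (open_near_eq (U := local_dom c c id)).
- by apply: open_local_dom => //; case: smooth_map_id.
- by move=> z [q [dq _] <-]; rewrite local_repE.
- exact: local_domI.
Qed.

Lemma tangent_mapE Phi p :
  tangent_map A Phi p = local_jac (chart_at A p) (chart_at A (Phi p)) Phi p.
Proof. by rewrite local_jac.unlock. Qed.

Lemma from_chartE c p : from_chart A c p = local_jac c (chart_at A p) id p.
Proof. by rewrite local_jac.unlock. Qed.

(** Chain rule for the two factorizations of Phi, read from the chart c to the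
    preferred chart at Phi p: through the preferred chart at p, or through c'. *)
Lemma from_chart_tangent_map c c' Phi p : smooth_map A Phi ->
  charts A c -> charts A c' -> cdom c p -> cdom c' (Phi p) ->
  from_chart A c p *m tangent_map A Phi p =
  local_jac c c' Phi p *m from_chart A c' (Phi p).
Proof.
move=> sP cc cc' d d'; rewrite !from_chartE tangent_mapE.
have sid := smooth_map_id.
have ca := charts_at p; have ca' := charts_at (Phi p).
have da := cdom_at p; have da' := cdom_at (Phi p).
rewrite -(@local_jac_comp c _ (chart_at A (Phi p)) id Phi p) //.
by rewrite -(@local_jac_comp c c' (chart_at A (Phi p)) Phi id p).
Qed.

Lemma from_chart_unit c p : charts A c -> cdom c p -> from_chart A c p \in unitmx.
Proof.
move=> cc d; have sid := smooth_map_id.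
have ca := charts_at p; have da := cdom_at p.
have := @local_jac_comp c (chart_at A p) c id id p sid sid sid cc ca cc d da d.
rewrite local_jac_id // => /esym/mulmx1_unit[].
by rewrite from_chartE.
Qed.

Lemma tangent_map_cancel Phi Psi p : smooth_map A Phi -> smooth_map A Psi ->
  cancel Phi Psi -> tangent_map A Phi p *m tangent_map A Psi (Phi p) = 1%:M.
Proof.
move=> s1 s2 K; rewrite !tangent_mapE K.
have e : Psi \o Phi = id by apply: funext => q; exact: K.
have da' := cdom_at (Phi p); have da := cdom_at p.
rewrite -local_jac_comp ?e ?K //; try exact: charts_at.
  by rewrite local_jac_id //; exact: charts_at.
exact: smooth_map_id.
Qed.

End Charts.

(** * Differential forms under a diffeomorphism *)

Section Forms.
Context {R : realType} {n : nat} {M : topologicalType}.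
Variable A : smooth_atlas R n M.
Implicit Types (c : chart R n M) (Phi Psi : M -> M) (p : M) (e : M -> R).

Definition locally_constant e := forall p, \forall q \near p, e q = e p.

(** The pullback of forms up to a function e; e is 1, or the sign that compares the
    orientations at p and at Phi p. *)
Definition scaled_pullback k e Phi (w : @kform R n M k) : @kform R n M k :=
  fun p u => e p * pullback A Phi w p u.

(** In charts the pullback by Phi is the pullback by its local representation. *)
Lemma form_in_chart_pullback k e Phi c c' (w : @kform R n M k) z u :
  smooth_map A Phi -> charts A c -> charts A c' -> local_dom c c' Phi z ->
  form_in_chart A c (scaled_pullback e Phi w) z u =
  e (cinv c z) * form_in_chart A c' w (local_rep c c' Phi z)
     (u *m local_jac c c' Phi (cinv c z)).
Proof.
move=> sP cc cc' [p [d d'] <-].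
rewrite (local_repE c' Phi cc d) /form_in_chart (cinvK cc d) (cinvK cc' d').
rewrite /scaled_pullback /pullback -!mulmxA.
by rewrite (from_chart_tangent_map sP cc cc' d d').
Qed.

Lemma mul_local_jac_cinv Phi c c' z v : smooth_map A Phi -> charts A c -> charts A c' ->
  local_dom c c' Phi z ->
  v *m local_jac c c' Phi (cinv c z) = 'D_v (local_rep c c' Phi) z.
Proof.
move=> sP cc cc' [p [d d'] <-].
by rewrite (cinvK cc d) (mul_local_jac v sP cc cc' d d').
Qed.

Lemma form_in_chart_alt k c (w : @kform R n M k) z :
  (forall p, is_alt (w p)) -> is_alt (form_in_chart A c w z).
Proof. by move=> hw; exact: alt_comp. Qed.

Lemma locally_constant_open e p : locally_constant e ->
  exists N, [/\ open N, N p & forall q, N q -> e q = e p].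
Proof.
move=> /(_ p) h; exists (interior [set q | e q = e p]); split=> //.
- exact: open_interior.
- by move=> q /interior_subset.
Qed.

(** On S the form [scaled_pullback e Phi w], read in c, is the constant e p times
    the pullback of w by the local representation. *)
Lemma adapted_chart_domain e Phi c c' p : continuous Phi -> locally_constant e ->
  charts A c -> charts A c' -> cdom c p -> cdom c' (Phi p) ->
  exists S, [/\ open S, S (cmap c p), S `<=` local_dom c c' Phi &
                forall z, S z -> e (cinv c z) = e p].
Proof.
move=> cP le cc cc' d d'; have [N [oN Np eN]] := locally_constant_open p le.
exists (cmap c @` (cdom c `&` (Phi @^-1` cdom c' `&` N))); split.
- apply: open_cmap_image; first exact: chartsP cc.
  by apply: openI => //; apply: open_preimage => //; exact: open_cdom cc'.
- by exists p.
- by move=> z [q [dq [dq' _]] <-]; exists q.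
- by move=> z [q [dq [_ /eN <-]] <-]; rewrite (cinvK cc dq).
Qed.

(** Near each point the coefficients of the pullback are polynomials in the first
    derivatives of the local representation F and in the coefficients of w
    composed with F. *)
Lemma smooth_scaled_pullback k e Phi (w : @kform R n M k) :
  smooth_map A Phi -> locally_constant e -> smooth_form A w ->
  smooth_form A (scaled_pullback e Phi w).
Proof.
move=> sP le [wa ws]; split=> [p|c cc u m].
  by apply: alt_scale; exact: (alt_comp (tangent_map A Phi p) (wa (Phi p))).
apply: Cn_on_local => x [p d <-].
pose c' := chart_at A (Phi p).
have cc' : charts A c' := charts_at A (Phi p).
have d' : cdom c' (Phi p) := cdom_at A (Phi p).
have [S [oS Sp SD SN]] := adapted_chart_domain (proj1 sP) le cc cc' d d'.
exists S; split => //.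
have sF m' : Cn_on m' S (local_rep c c' Phi).
  by apply: Cn_on_subset (local_smooth sP cc cc' m') => z /SD.
pose W f z : R^o := form_in_chart A c' w z (rowsub f 1%:M).
apply: (@Cn_on_ext _ _ _ m S (fun z => e p *
   \sum_(f : {ffun 'I_k -> 'I_n}) ((\prod_r ('D_(row r u) (local_rep c c' Phi) z) 0 (f r)) *
      W f (local_rep c c' Phi z)) : R^o)) => //.
  move=> z Sz; rewrite (form_in_chart_pullback _ _ _ sP cc cc' (SD _ Sz)) (SN _ Sz).
  rewrite -[X in form_in_chart _ _ _ _ X]mulmx1 multilinear_mul; last first.
    exact/is_alt_multilinear/form_in_chart_alt.
  congr (_ * _); apply: eq_bigr => f _; congr (_ * _); apply: eq_bigr => r _.
  rewrite -(mul_local_jac_cinv (row r u) sP cc cc' (SD _ Sz)) -row_mul.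
  by rewrite !mxE.
apply: Cn_onM => //; first exact: Cn_on_cst.
apply: Cn_on_sum => // f; apply: Cn_onM => //.
  apply: Cn_on_prod => // r; apply: Cn_on_coord => //.
  by have [_ h] := sF m.+1; exact: h.
apply: (Cn_on_comp (W := cmap c' @` cdom c') oS _ (ws c' cc' _ m) (sF m)).
by move=> z /SD [q [dq dq'] <-]; rewrite (local_repE c' Phi cc dq); exists (Phi q).
Qed.

Lemma ext_deriv_smooth k (w : @kform R n M k) p : smooth_form A w ->
  ext_deriv A w p = ext_d (form_in_chart A (chart_at A p) w) (cmap (chart_at A p) p).
Proof. by move=> sw; apply: funext => u; rewrite /ext_deriv asboolT. Qed.

Lemma ext_deriv_nonsmooth k (w : @kform R n M k) p u : ~ smooth_form A w ->
  ext_deriv A w p u = 0.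
Proof. by move=> sw; rewrite /ext_deriv asboolF. Qed.

Lemma form_in_chart_differentiable k c (w : @kform R n M k) p u :
  smooth_form A w -> charts A c -> cdom c p ->
  differentiable (fun z => form_in_chart A c w z u : R^o) (cmap c p).
Proof.
move=> [_ sw] cc d; have [h _] := sw c cc u 1; apply: h; by exists p.
Qed.

Lemma ext_deriv_scaled_pullback_of_smooth k e Phi (w : @kform R n M k) :
  smooth_map A Phi -> locally_constant e -> smooth_form A w ->
  ext_deriv A (scaled_pullback e Phi w) = scaled_pullback e Phi (ext_deriv A w).
Proof.
move=> sP le sw; apply: funext => p.
rewrite ext_deriv_smooth; last exact: smooth_scaled_pullback.
apply: funext => u; rewrite /scaled_pullback /pullback (ext_deriv_smooth _ sw).
set c := chart_at A p; set c' := chart_at A (Phi p).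
have cc : charts A c := charts_at A p.
have cc' : charts A c' := charts_at A (Phi p).
have d : cdom c p := cdom_at A p.
have d' : cdom c' (Phi p) := cdom_at A (Phi p).
have [S [oS Sp SD SN]] := adapted_chart_domain (proj1 sP) le cc cc' d d'.
have sF : Cn_on 2 S (local_rep c c' Phi).
  by apply: Cn_on_subset (local_smooth sP cc cc' 2) => z /SD.
have jF v z : S z -> v *m local_jac c c' Phi (cinv c z) = 'D_v (local_rep c c' Phi) z.
  by move=> /SD; exact: mul_local_jac_cinv.
pose W z v := e p * form_in_chart A c' w z v.
have FpE := local_repE c' Phi cc d.
have dW v : differentiable (fun z => form_in_chart A c' w z v : R^o) (cmap c' (Phi p)).
  exact: form_in_chart_differentiable.
have WE : ext_d (form_in_chart A c (fun p u => e p * w (Phi p) (u *m tangent_map A Phi p)))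
    (cmap c p) = ext_d (fun z u => W (local_rep c c' Phi z)
      (u *m local_jac c c' Phi (cinv c z))) (cmap c p).
  apply: ext_d_near => v; apply: filterS (open_nbhs_nbhs (conj oS Sp)) => z Sz.
  rewrite /W -(SN z Sz).
  exact: (@form_in_chart_pullback k e Phi c c' w z v sP cc cc' (SD z Sz)).
rewrite WE {WE}.
have aW z : is_alt (W z) by apply: alt_scale; exact: form_in_chart_alt (proj1 sw).
have dWF v : differentiable (fun z => W z v : R^o) (local_rep c c' Phi (cmap c p)).
  by rewrite FpE; exact: (differentiableZ (e p) (dW v)).
rewrite (ext_d_comp oS Sp sF jF openT I (fun z _ => aW z) dWF).
rewrite FpE (cinvK cc d) (ext_dZ _ _ dW) tangent_mapE.
by [].
Qed.

Lemma pullback_cancel k Phi Psi (w : @kform R n M k) :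
  smooth_map A Phi -> smooth_map A Psi -> cancel Phi Psi ->
  pullback A Phi (pullback A Psi w) = w.
Proof.
move=> s1 s2 K; apply: funext => p; apply: funext => u.
by rewrite /pullback -mulmxA tangent_map_cancel // mulmx1 K.
Qed.

(** If w is not smooth then neither is its pullback, because w is recovered from
    it by pulling back along Psi; both sides are then 0. *)
Lemma ext_deriv_scaled_pullback k e Phi Psi (w : @kform R n M k) :
  smooth_map A Phi -> smooth_map A Psi -> cancel Phi Psi -> cancel Psi Phi ->
  locally_constant e -> (forall p, e p * e p = 1) ->
  ext_deriv A (scaled_pullback e Phi w) = scaled_pullback e Phi (ext_deriv A w).
Proof.
move=> s1 s2 K1 K2 le ee.
have [sw|nsw] := pselect (smooth_form A w).
  exact: ext_deriv_scaled_pullback_of_smooth.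
apply: funext => p; apply: funext => u.
rewrite /scaled_pullback /pullback (ext_deriv_nonsmooth _ _ nsw) mulr0.
apply: ext_deriv_nonsmooth => sw; apply: nsw.
have leP : locally_constant (e \o Psi).
  by move=> q; have /(_ q) cP := proj1 s2; exact: (cP _ (le (Psi q))).
have := smooth_scaled_pullback s2 leP sw; congr smooth_form.
apply: funext => q; apply: funext => v; rewrite /scaled_pullback /=.
rewrite -[pullback _ _ _ _ _]/(e (Psi q) * pullback A Psi (pullback A Phi w) q v).
by rewrite pullback_cancel // mulrA ee mul1r.
Qed.

Lemma ext_deriv_multilinear k (w : @kform R n M k) p :
  smooth_form A w -> multilinear (ext_deriv A w p).
Proof.
move=> sw; rewrite ext_deriv_smooth //; apply: ext_d_multilinear => [z|v].
  exact/is_alt_multilinear/form_in_chart_alt/(proj1 sw).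
by apply: form_in_chart_differentiable => //; [exact: charts_at|exact: cdom_at].
Qed.

End Forms.

(** * Invariance of the induced Hodge Laplacian *)

Lemma sg_locally_constant (R : realType) (T : topologicalType) (f : T -> R^o) (x : T) :
  {for x, continuous f} -> f x != 0 -> \forall y \near x, Num.sg (f y) = Num.sg (f x).
Proof.
move=> cf fx0; have fx : 0 < `|f x| by rewrite normr_gt0.
have /cvgrPdist_lt/(_ _ fx) := cf; apply: filterS => y.
case: (ltrgt0P (f x)) fx0 => // h _ hy.
  by rewrite (gtr0_sg h) gtr0_sg //; move: hy; rewrite ltr_distlC ltrBlDr; lra.
by rewrite (ltr0_sg h) ltr0_sg //; move: hy; rewrite ltr_distlC; lra.
Qed.

Lemma near_continuous (T U : topologicalType) (f : T -> U) (x : T) (P : U -> Prop) :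
  {for x, continuous f} -> (\forall y \near f x, P y) -> \forall z \near x, P (f z).
Proof. by move=> cf; exact: cf. Qed.

Section Invariance.
Context {R : realType} {n : nat} {M : topologicalType}.
Variables (A : smooth_atlas R n M) (g : riemannian_metric A) (o : orientation A).
Variables (Phi Psi : M -> M).
Hypotheses (PhiK : cancel Phi Psi) (PsiK : cancel Psi Phi).
Hypotheses (sPhi : smooth_map A Phi) (sPsi : smooth_map A Psi).
Hypothesis gPhi : forall p,
  tangent_map A Phi p *m g (Phi p) *m (tangent_map A Phi p)^T = g p.

(** 1 where Phi preserves the orientation, -1 where it reverses it. *)
Definition orientation_sign p : R :=
  o p * o (Phi p) * Num.sg (\det (tangent_map A Phi p)).

Lemma orientE p : o p * o p = 1.
Proof. by have [->|->] := orient_sign o p; rewrite ?mulr1 // mulrNN mulr1. Qed.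

Lemma tangent_map_unit p : tangent_map A Phi p \in unitmx.
Proof. exact: (mulmx1_unit (tangent_map_cancel p sPhi sPsi PhiK)).1. Qed.

Lemma sg_sqr (x : R) : x != 0 -> Num.sg x * Num.sg x = 1.
Proof. by move=> x0; rewrite -expr2 sqr_sg x0. Qed.

Lemma det_unit_neq0 (B : 'M[R]_n) : B \in unitmx -> \det B != 0.
Proof. by rewrite unitmxE unitfE. Qed.

Lemma orientation_sign_sqr p : orientation_sign p * orientation_sign p = 1.
Proof.
have sg2 := sg_sqr (det_unit_neq0 (tangent_map_unit p)).
rewrite /orientation_sign; set t := Num.sg _ in sg2 *.
by transitivity ((o p * o p) * (o (Phi p) * o (Phi p)) * (t * t));
   [ring|rewrite !orientE sg2 !mulr1].
Qed.

Lemma unitmx_of_mul_eq (F T J F' : 'M[R]_n) : F *m T = J *m F' ->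
  F \in unitmx -> T \in unitmx -> J \in unitmx.
Proof.
by move=> e uF uT; have := unitmx_mul F T; rewrite e uF uT unitmx_mul => /andP[].
Qed.

Lemma sg_det_conj (F T J F' : 'M[R]_n) (a b : R) : F \in unitmx -> F' \in unitmx ->
  F *m T = J *m F' ->
  a * b * Num.sg (\det T) =
  (a * Num.sg (\det F)) * (b * Num.sg (\det F')) * Num.sg (\det J).
Proof.
move=> /det_unit_neq0/sg_sqr uF /det_unit_neq0/sg_sqr uF' e.
have := congr1 (fun X => Num.sg (\det X)) e; rewrite /= !det_mulmx !sgrM.
move: uF uF'; move: (Num.sg (\det F)) (Num.sg (\det F')) => f f'.
move: (Num.sg (\det T)) (Num.sg (\det J)) => t j ff ff' {}e.
transitivity (a * b * (f * f) * t); first by rewrite ff mulr1.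
by transitivity (a * b * f * (f * t)); [ring|rewrite e; ring].
Qed.

(** In charts around p and Phi p the sign is a product of the signs of the two
    coordinate frames, locally constant by definition of an orientation, and of
    the sign of the Jacobian determinant, continuous and nonzero. *)
Lemma orientation_sign_locally_constant : locally_constant orientation_sign.
Proof.
move=> p; pose c := chart_at A p; pose c' := chart_at A (Phi p).
have cc : charts A c := charts_at A p.
have cc' : charts A c' := charts_at A (Phi p).
have d : cdom c p := cdom_at A p.
have d' : cdom c' (Phi p) := cdom_at A (Phi p).
have oS := open_local_dom cc cc' (proj1 sPhi).
have sF := local_smooth sPhi cc cc' 1.
pose D z : R^o := \det (\matrix_(i, j)
  ('D_(delta_mx 0 i) (local_rep c c' Phi) z) 0 j : 'M[R]_n).
have DE q : cdom c q -> cdom c' (Phi q) -> D (cmap c q) = \det (local_jac c c' Phi q).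
  move=> dq dq'; congr (\det _); apply/matrixP => i j; rewrite mxE.
  by rewrite -(mul_local_jac _ sPhi cc cc' dq dq') -rowE mxE.
have cD : {for cmap c p, continuous D}.
  have CD : Cn_on 0 (local_dom c c' Phi) D.
    apply: Cn_on_sum => // s; apply: Cn_onM => //; first exact: Cn_on_cst.
    apply: Cn_on_prod => // i.
    under eq_fun do rewrite mxE.
    have CF : Cn_on 0 (local_dom c c' Phi) ('D_(delta_mx 0 i) (local_rep c c' Phi)).
      exact: (proj2 sF).
    exact: Cn_on_coord 0 (s i) oS CF.
  by apply: CD; exact: local_domI.
have cm : {for p, continuous (cmap c)} by have [_ h _ _] := chartsP cc; exact: h.
have sgE q : cdom c q -> cdom c' (Phi q) -> orientation_sign q =
    (o q * Num.sg (\det (from_chart A c q))) *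
    (o (Phi q) * Num.sg (\det (from_chart A c' (Phi q)))) * Num.sg (D (cmap c q)).
  move=> dq dq'; rewrite DE // /orientation_sign.
  apply: sg_det_conj; [exact: from_chart_unit|exact: from_chart_unit|].
  exact: from_chart_tangent_map.
have n1 := orient_locally_constant o cc d.
pose P q := o q * Num.sg (\det (from_chart A c' q)) =
            o (Phi p) * Num.sg (\det (from_chart A c' (Phi p))).
have nP : nbhs (Phi p) P := orient_locally_constant o cc' d'.
have n2 : \forall q \near p, P (Phi q) :=
  near_continuous (proj1 sPhi p) nP.
have D0 : D (cmap c p) != 0.
  rewrite DE //; apply: det_unit_neq0.
  have := unitmx_of_mul_eq (from_chart_tangent_map sPhi cc cc' d d').
  by apply; [exact: from_chart_unit|exact: tangent_map_unit].
have n3 : \forall q \near p, Num.sg (D (cmap c q)) = Num.sg (D (cmap c p)).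
  exact: (near_continuous (P := fun y => Num.sg (D y) = _) cm (sg_locally_constant cD D0)).
have n4 : \forall q \near p, cdom c q := open_nbhs_nbhs (conj (open_cdom cc) d).
have n5 : \forall q \near p, cdom c' (Phi q).
  exact: (proj1 sPhi p _ (open_nbhs_nbhs (conj (open_cdom cc') d'))).
apply: filterS (filterI n1 (filterI n2 (filterI n3 (filterI n4 n5)))).
move=> q [h1 [h2 [h3 [h4 h5]]]].
apply: etrans (sgE q h4 h5) (etrans _ (esym (sgE p d d'))).
exact: (congr2 *%R (congr2 *%R h1 h2) h3).
Qed.

Lemma gram_det_gt0 p : 0 < \det (g p).
Proof. exact: posdef_det_gt0 (gram_sym g p) (@gram_pos _ _ _ _ g p). Qed.

Lemma star_form_pullback k l (w : @kform R n M k) : (forall p, multilinear (w p)) ->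
  star_form g o (l := l) (pullback A Phi w) =
  scaled_pullback A orientation_sign Phi (star_form g o w).
Proof.
move=> hw; apply: funext => p.
exact: (star_comp l (orientE p) (orientE (Phi p)) (hw (Phi p)) (tangent_map_unit p)
  (gPhi p) (gram_det_gt0 p) (gram_det_gt0 (Phi p))).
Qed.

Lemma star_form_inv_pullback k l (w : @kform R n M l) :
  star_form_inv g o (k := k) (scaled_pullback A orientation_sign Phi w) =
  pullback A Phi (star_form_inv g o w).
Proof.
apply: funext => p.
exact: (star_inv_comp k (w (Phi p)) (orientE p) (orientE (Phi p)) (tangent_map_unit p)
  (gPhi p) (gram_det_gt0 p) (gram_det_gt0 (Phi p))).
Qed.

(** The sign produced by the star passes through d and is absorbed by the inverse
    star. *)
Lemma codiff_pullback k (w : @kform R n M k.+1) : (forall p, multilinear (w p)) ->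
  codiff g o (pullback A Phi w) = pullback A Phi (codiff g o w).
Proof.
move=> hw; apply: funext => p; apply: funext => u; rewrite /codiff.
rewrite (star_form_pullback _ hw).
rewrite (ext_deriv_scaled_pullback _ sPhi sPsi PhiK PsiK
  orientation_sign_locally_constant orientation_sign_sqr).
by rewrite star_form_inv_pullback.
Qed.

Variables v1 v2 : M -> 'rV[R]_n.
Hypothesis v12 : is_pushforward A Phi v1 v2.

Lemma twist_form_pullback k (w : @kform R n M k) :
  twist_form g v1 (pullback A Phi w) = pullback A Phi (twist_form g v2 w).
Proof.
apply: funext => p; rewrite /twist_form /pullback v12.
exact: (twist_comp (v1 p) (w (Phi p)) (gPhi p)).
Qed.

Lemma flat_ge0 p (v : 'rV[R]_n) : 0 <= flat (g p) v v.
Proof.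
have [->|v0] := eqVneq v 0; first by rewrite /flat !mul0mx mxE.
exact/ltW/gram_pos.
Qed.

Lemma twist_form_inv_pullback k (w : @kform R n M k) :
  twist_form_inv g v1 (pullback A Phi w) = pullback A Phi (twist_form_inv g v2 w).
Proof.
apply: funext => p; rewrite /twist_form_inv /pullback v12.
exact: (twist_inv_comp (w (Phi p)) (flat_ge0 p (v1 p)) (tangent_map_unit p) (gPhi p)).
Qed.

Lemma induced_codiff_pullback k (w : @kform R n M k.+1) :
  (forall p, multilinear (w p)) ->
  induced_codiff g o v1 (pullback A Phi w) = pullback A Phi (induced_codiff g o v2 w).
Proof.
move=> hw; rewrite /induced_codiff twist_form_pullback codiff_pullback.
  exact: twist_form_inv_pullback.
by move=> p; exact: (twist_multilinear (g p) (v2 p) (hw p)).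
Qed.

Lemma pullback_scaled k (w : @kform R n M k) :
  pullback A Phi w = scaled_pullback A (fun=> 1) Phi w.
Proof. by apply: funext => p; apply: funext => u; rewrite /scaled_pullback mul1r. Qed.

Lemma locally_constant1 : @locally_constant R M (fun=> 1).
Proof. by move=> p; exact: nearW. Qed.

Lemma ext_deriv_pullback k (w : @kform R n M k) :
  ext_deriv A (pullback A Phi w) = pullback A Phi (ext_deriv A w).
Proof.
rewrite !pullback_scaled.
apply: (ext_deriv_scaled_pullback _ sPhi sPsi PhiK PsiK locally_constant1) => p.
exact: mulr1.
Qed.

Lemma smooth_pullback k (w : @kform R n M k) :
  smooth_form A w -> smooth_form A (pullback A Phi w).
Proof. by rewrite pullback_scaled; exact: smooth_scaled_pullback sPhi locally_constant1. Qed.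

Lemma induced_laplacian_pullback k (w : @kform R n M k) : smooth_form A w ->
  pullback A Phi (induced_laplacian g o v2 w) =
  induced_laplacian g o v1 (pullback A Phi w).
Proof.
move=> sw.
have dw p : multilinear (ext_deriv A w p) by exact: ext_deriv_multilinear.
case: k w sw dw => [|k] w sw dw /=.
  by rewrite ext_deriv_pullback induced_codiff_pullback.
have hw p : multilinear (w p) by apply: is_alt_multilinear; exact: (proj1 sw).
rewrite ext_deriv_pullback (induced_codiff_pullback dw) (induced_codiff_pullback hw).
by rewrite ext_deriv_pullback.
Qed.

Lemma eigenforms_pullback k lam (w : @kform R n M k) :
  eigenforms g o k v2 lam w -> eigenforms g o k v1 lam (pullback A Phi w).
Proof.
move=> [sw [q [u wu]] ew]; split; first exact: smooth_pullback.
  exists (Psi q), (u *m tangent_map A Psi q).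
  rewrite -[pullback _ _ _ _ _]/(pullback A Psi (pullback A Phi w) q u).
  by rewrite (pullback_cancel w sPsi sPhi PsiK).
move=> p u'; rewrite -induced_laplacian_pullback //.
exact: ew.
Qed.

(** Apply the intertwining relation to the pullback of w along Psi, and pull back
    the resulting equation along Psi. *)
Lemma eigenforms_pullback_inv k lam (w : @kform R n M k) :
  eigenforms g o k v1 lam w ->
  smooth_form A (pullback A Psi w) -> eigenforms g o k v2 lam (pullback A Psi w).
Proof.
move=> [sw [q [u wu]] ew] sw'; split=> //.
  exists (Phi q), (u *m tangent_map A Phi q).
  rewrite -[pullback _ _ _ _ _]/(pullback A Phi (pullback A Psi w) q u).
  by rewrite (pullback_cancel w sPhi sPsi PhiK).
move=> p u'.
rewrite -[induced_laplacian g o v2 _](pullback_cancel _ sPsi sPhi PsiK).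
rewrite induced_laplacian_pullback // (pullback_cancel w sPhi sPsi PhiK).
exact: ew.
Qed.

End Invariance.

Theorem proposition5p2 (R : realType) (n : nat) (M : topologicalType)
    (A : smooth_atlas R n M) (g : riemannian_metric A) (o : orientation A)
    (Phi : M -> M) (v1 v2 : M -> 'rV[R]_n) (k : nat)
    (M_compact : compact [set: M]) (M_hausdorff : hausdorff_space M)
    (Phi_isometry : is_isometry g Phi)
    (v1_smooth : smooth_field A v1) (v2_smooth : smooth_field A v2)
    (v2_pushforward : is_pushforward A Phi v1 v2) :
  (forall w : kform k, smooth_form A w ->
     pullback A Phi (induced_laplacian g o v2 w) =
     induced_laplacian g o v1 (pullback A Phi w)) /\
  (forall lam : R, is_eigenvalue g o k v1 lam <-> is_eigenvalue g o k v2 lam) /\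
  (forall lam : R,
     set_bij (eigenforms g o k v2 lam) (eigenforms g o k v1 lam)
             (pullback A Phi)).
Proof.
case: Phi_isometry => -[Psi [PhiK PsiK sPhi sPsi]] gPhi.
have eig lam w : eigenforms g o k v2 lam w -> eigenforms g o k v1 lam (pullback A Phi w).
  by move=> ew; exact: (eigenforms_pullback PhiK PsiK sPhi sPsi gPhi v2_pushforward ew).
have eig' lam w : eigenforms g o k v1 lam w -> eigenforms g o k v2 lam (pullback A Psi w).
  move=> ew; have sw := smooth_pullback sPsi (let: And3 sw _ _ := ew in sw).
  exact: (eigenforms_pullback_inv PhiK PsiK sPhi sPsi gPhi v2_pushforward ew sw).
split; [|split] => [w sw|lam|lam].
- exact: (induced_laplacian_pullback o PhiK PsiK sPhi sPsi gPhi v2_pushforward sw).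
- by split=> -[w ew]; [exists (pullback A Psi w); exact: eig'
                      |exists (pullback A Phi w); exact: eig].
- split=> [w ew|w w' _ _ e|w ew]; first exact: eig.
  + rewrite -(pullback_cancel w sPsi sPhi PsiK) e.
    exact: pullback_cancel sPsi sPhi PsiK.
  + exists (pullback A Psi w); first exact: eig'.
    exact: pullback_cancel sPhi sPsi PhiK.
Qed.
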